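(* For every positive integer $n$, every integer $m\ge2$ and all $x,y\in\mathbb{R}^m\setminus\{0\}$, the kernel of the $(0,2/n)$-generalized Fourier transform satisfies $|K^{m}_{2/n}(x,y)|\le1$.
   Context: For $a>0$, $m\ge2$, $\lambda=(m-2)/2$, $z=|x||y|$, $\xi=\langle x,y\rangle/z$, the kernel is $K_{a}^{m}(x,y)=a^{2\lambda/a}\Gamma(\frac{2\lambda+a}{a})\sum_{j=0}^{\infty}e^{-\frac{i\pi j}{a}}\frac{\lambda+j}{\lambda}z^{-\lambda}J_{\frac{2(j+\lambda)}{a}}(\frac{2}{a}z^{a/2})C^{\lambda}_{j}(\xi)$, with $J_\nu$ the Bessel function, $C_j^\lambda$ the Gegenbauer polynomial, and for $\lambda=0$ the factor $\frac{\lambda+j}{\lambda}C_j^\lambda(\xi)$ understood as its limit as $\lambda\to0$. *)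

(* Defs.v *)
From Stdlib Require Import Reals Factorial.
From Coquelicot Require Import Coquelicot.
Open Scope R_scope.

Definition Gamma (s : R) : R :=
  RInt_gen (fun t => Rpower t (s - 1) * exp (- t)) (at_right 0) (Rbar_locally p_infty).

Definition BesselJ (nu t : R) : R :=
  Series (fun k => (-1) ^ k / (INR (Factorial.fact k) * Gamma (INR k + nu + 1))
                   * Rpower (t / 2) (2 * INR k + nu)).

(* Gegenbauer polynomials via the standard three-term recurrence:
   C_0 = 1, C_1 = 2 lam x,
   (j+1) C_{j+1} = 2 x (j+lam) C_j - (j + 2 lam - 1) C_{j-1}.
   geg_pair lam x j = (C_j^lam(x), C_{j+1}^lam(x)). *)
Fixpoint geg_pair (lam x : R) (j : nat) : R * R :=
  match j with
  | O => (1, 2 * lam * x)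
  | S j' => let (c0, c1) := geg_pair lam x j' in
            (c1, (2 * x * (INR j + lam) * c1 - (INR j + 2 * lam - 1) * c0) / (INR j + 1))
  end.

Definition Gegenbauer (lam : R) (j : nat) (x : R) : R := fst (geg_pair lam x j).

Definition geg_factor (lam : R) (j : nat) (xi : R) : R :=
  if Req_EM_T lam 0
  then real (Lim (fun l => (l + INR j) / l * Gegenbauer l j xi) 0)
  else (lam + INR j) / lam * Gegenbauer lam j xi.

(* Vectors of R^m: functions nat -> R, only the coordinates 0..m-1 are used. *)
Definition dotm (m : nat) (x y : nat -> R) : R :=
  match m with O => 0 | S m' => sum_f_R0 (fun i => x i * y i) m' end.
Definition normm (m : nat) (x : nat -> R) : R := sqrt (dotm m x x).
Definition nonzero_vec (m : nat) (x : nat -> R) : Prop := exists i, (i < m)%nat /\ x i <> 0.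

Definition kernel_coef (a : R) (m : nat) (x y : nat -> R) (j : nat) : R :=
  let lam := (INR m - 2) / 2 in
  let z := normm m x * normm m y in
  let xi := dotm m x y / z in
  Rpower a (2 * lam / a) * Gamma ((2 * lam + a) / a)
  * geg_factor lam j xi * Rpower z (- lam)
  * BesselJ (2 * (INR j + lam) / a) (2 / a * Rpower z (a / 2)).

(* K_a^m(x,y) = sum_j e^{-i pi j / a} * kernel_coef j, as a complex number
   (real part, imaginary part), with e^{-i t} = cos t - i sin t. *)
Definition Kernel (a : R) (m : nat) (x y : nat -> R) : C :=
  (Series (fun j => cos (PI * INR j / a) * kernel_coef a m x y j),
   Series (fun j => - sin (PI * INR j / a) * kernel_coef a m x y j)).

(* Main.v *)
Require Import Defs.
From Stdlib Require Import Reals Lra Lia List Factorial.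
From Coquelicot Require Import Coquelicot.
Open Scope R_scope.

(** Write [lam = (m - 2) / 2], [nu = n lam], [xi = cos th] and [w = n z^(1/n)].  Expanding
    the Bessel functions, the kernel is [sum_p (- i w)^p / p! M_p], where [M_p] is a finite
    sum of Gegenbauer values.  With [c_k = cos ((th + 2 pi k) / n)] one has
    [1 - 2 xi s^n + s^(2n) = prod_k (1 - 2 c_k s + s^2)]; comparing the powers [-lam] of
    both sides identifies [M_p] with [p! h_p / (nu)_p], where
    [sum_p h_p r^p = prod_k (1 - c_k r)^(-lam)].  These are the moments of [sum_k t_k c_k]
    for [t] distributed on the simplex according to the Dirichlet law with parameters
    [(lam, ..., lam)] (the uniform law on the [c_k] if [lam = 0]).  So the kernel is the
    Fourier transform at [w] of a probability measure on [[-1, 1]], and has modulus at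
    most 1.

    The Dirichlet law is built one coordinate at a time by Beta laws; as [2 lam] is an
    integer, the substitution [t = sin^2 phi] makes them continuous densities on
    [[0, pi/2]].  The case [lam = 0] of the identity for [M_p] is the limit of the case
    [lam > 0]. *)

(** * The Gamma function on [[1, +oo)] *)

(** For [a = 2 / n] the phase of the [j]-th summand is [(-i)^(n j)] and its Bessel index is
    [n j + nu]. Up to a common power [nu], the [k]-th Bessel term carries [(w / 2)^(n j + 2 k)] and
    the sign [(-1)^k], and [(-1)^k (-i)^(n j) = (-i)^(n j + 2 k)]: phase and sign depend together
    only on the total degree [p = n j + 2 k]. Collecting by [p] leaves one factor [(- i w)^p]. The
    prefactor [Gamma (nu + 1)] turns every other Gamma value into a Pochhammer symbol, so the
    coefficients are rational in [lam].

    The product identity expresses Gegenbauer values through the [h_p], whereas [M_p] is a sum of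
    Gegenbauer values; a triangular relation has to be inverted in between.

    No measure is constructed. A probability law on [[-1, 1]] is represented by its moments, subject
    to positivity on polynomials that are non-negative on [[-1, 1]]. This property survives affine
    maps and mixtures, and applied to Taylor polynomials it already gives the bound on the Fourier
    transform. *)

Lemma exp_nondecreasing x y : x <= y -> exp x <= exp y.
Proof. intros [H| ->]; [left; now apply exp_increasing|apply Rle_refl]. Qed.

Definition gamma_fun (s t : R) : R := Rpower t (s - 1) * exp (- t).

Lemma gamma_fun_pos s t : 0 < gamma_fun s t.
Proof. apply Rmult_lt_0_compat; apply exp_pos. Qed.

Lemma continuous_gamma_fun s t : 0 < t -> continuous (gamma_fun s) t.
Proof.
  intros Ht. apply (ex_derive_continuous (K := R_AbsRing) (V := R_NormedModule)).
  unfold gamma_fun, Rpower. auto_derive. lra.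
Qed.

Lemma ex_RInt_gamma_fun s a b : 0 < a -> 0 < b -> ex_RInt (gamma_fun s) a b.
Proof.
  intros Ha Hb. apply (ex_RInt_continuous (V := R_CompleteNormedModule)).
  intros t Ht. apply continuous_gamma_fun.
  apply Rlt_le_trans with (2 := proj1 Ht). now apply Rmin_glb_lt.
Qed.

Lemma ln_le_linear t : 0 < t -> ln t <= t - 1.
Proof.
  intros Ht. rewrite <- (ln_exp (t - 1)).
  apply ln_le; [lra|]. generalize (exp_ineq1_le (t - 1)). lra.
Qed.

(** By concavity [ln t] lies below a line of slope [1 / (2 * s)], obtained at the point [2 * s]; so
    the factor [t^(s - 1)] costs at most half of the exponential decay. *)
Lemma gamma_fun_le s t : 1 <= s -> 0 < t ->
  gamma_fun s t <= exp ((s - 1) * ln (2 * s)) * exp (- t / 2).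
Proof.
  intros Hs Ht. unfold gamma_fun, Rpower. rewrite <- !exp_plus.
  assert (Hl : ln t <= ln (2 * s) + t / (2 * s)).
  { replace (ln t) with (ln (2 * s) + ln (t / (2 * s))).
    - generalize (ln_le_linear (t / (2 * s))).
      assert (0 < t / (2 * s)) by (apply Rdiv_lt_0_compat; lra). lra.
    - rewrite <- ln_mult; [f_equal; field; lra|lra|apply Rdiv_lt_0_compat; lra]. }
  assert (H1 : (s - 1) * ln t <= (s - 1) * ln (2 * s) + (s - 1) * (t / (2 * s))).
  { rewrite <- Rmult_plus_distr_l. apply Rmult_le_compat_l; lra. }
  assert (H2 : (s - 1) * (t / (2 * s)) <= t / 2).
  { replace ((s - 1) * (t / (2 * s))) with (t / 2 - t / (2 * s)) by (field; lra).
    assert (0 < t / (2 * s)) by (apply Rdiv_lt_0_compat; lra). lra. }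
  apply exp_nondecreasing. lra.
Qed.

Lemma RInt_gamma_fun_le s a b : 1 <= s -> 0 < a <= b ->
  RInt (gamma_fun s) a b <= 2 * exp ((s - 1) * ln (2 * s)).
Proof.
  intros Hs Hab. set (K := exp ((s - 1) * ln (2 * s))).
  assert (HK : 0 < K) by apply exp_pos.
  assert (HI : is_RInt (fun t => K * exp (- t / 2)) a b
     (minus (- 2 * K * exp (- b / 2)) (- 2 * K * exp (- a / 2)))).
  { apply (is_RInt_derive (fun t => - 2 * K * exp (- t / 2))).
    - intros t _. auto_derive; [easy|]. unfold Rdiv. now field_simplify_eq.
    - intros t _. apply (ex_derive_continuous (K := R_AbsRing) (V := R_NormedModule)).
      auto_derive; easy. }
  apply Rle_trans with (RInt (fun t => K * exp (- t / 2)) a b).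
  - apply RInt_le; [lra|apply ex_RInt_gamma_fun; lra|eexists; exact HI|].
    intros t Ht. apply gamma_fun_le; lra.
  - rewrite (is_RInt_unique _ _ _ _ HI). unfold minus, plus, opp; simpl.
    assert (0 < exp (- b / 2)) by apply exp_pos.
    assert (exp (- a / 2) <= 1) by (rewrite <- exp_0; apply exp_nondecreasing; lra).
    nra.
Qed.

(** The integrals over [[a, b]] grow with the interval and are bounded, since the integrand is
    positive; their supremum is therefore the limit along both ends. Only after this is the total
    function [RInt_gen] in [Gamma] known to return an actual integral. *)
Lemma Gamma_spec s : 1 <= s ->
  0 < Gamma s /\
  is_RInt_gen (gamma_fun s) (at_right 0) (Rbar_locally p_infty) (Gamma s).
Proof.
  intros Hs.
  set (E := fun v => exists a b, 0 < a <= b /\ v = RInt (gamma_fun s) a b).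
  destruct (completeness E) as [l [Hub Hlub]].
  { exists (2 * exp ((s - 1) * ln (2 * s))). intros v (a & b & Hab & ->).
    now apply RInt_gamma_fun_le. }
  { exists (RInt (gamma_fun s) 1 1), 1, 1. split; [lra|easy]. }
  assert (Hl : 0 < l).
  { apply Rlt_le_trans with (RInt (gamma_fun s) 1 2).
    - apply RInt_gt_0; [lra|intros; apply gamma_fun_pos|].
      intros; apply continuous_gamma_fun; lra.
    - apply Hub. exists 1, 2. split; [lra|easy]. }
  assert (HI : is_RInt_gen (gamma_fun s) (at_right 0) (Rbar_locally p_infty) l).
  { intros P [eps HP].
    assert (He : exists a b, 0 < a <= b /\ l - eps < RInt (gamma_fun s) a b).
    { destruct (Classical_Prop.classic
        (exists a b, 0 < a <= b /\ l - eps < RInt (gamma_fun s) a b)) as [H|H]; [easy|].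
      exfalso. assert (l <= l - eps).
      { apply Hlub. intros v (a & b & Hab & ->). apply Rnot_lt_le. intros Hlt.
        apply H. now exists a, b. }
      destruct eps as [e He]; simpl in *; lra. }
    destruct He as (a0 & b0 & Hab & Hlt).
    unfold filtermapi.
    apply (Filter_prod _ _ _ (fun a => 0 < a < a0) (fun b => b0 < b)).
    - assert (Ha0 : 0 < a0) by lra.
      exists (mkposreal a0 Ha0). intros y Hy Hy0. split; [easy|].
      unfold ball in Hy; simpl in Hy; unfold AbsRing_ball, abs, minus, plus, opp in Hy; simpl in Hy.
      apply Rabs_def2 in Hy. lra.
    - now exists b0.
    - intros a b Ha Hb. exists (RInt (gamma_fun s) a b). simpl. split.
      + apply (RInt_correct (V := R_CompleteNormedModule)). apply ex_RInt_gamma_fun; lra.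
      + apply HP. assert (Hle : RInt (gamma_fun s) a b <= l).
        { apply Hub. exists a, b. split; [lra|easy]. }
        assert (Hge : RInt (gamma_fun s) a0 b0 <= RInt (gamma_fun s) a b).
        { rewrite <- (RInt_Chasles (V := R_CompleteNormedModule) (gamma_fun s) a a0 b);
            try (apply ex_RInt_gamma_fun; lra).
          rewrite <- (RInt_Chasles (V := R_CompleteNormedModule) (gamma_fun s) a0 b0 b);
            try (apply ex_RInt_gamma_fun; lra).
          assert (0 <= RInt (gamma_fun s) a a0).
          { apply RInt_ge_0; [lra|apply ex_RInt_gamma_fun; lra|].
            intros; left; apply gamma_fun_pos. }
          assert (0 <= RInt (gamma_fun s) b0 b).
          { apply RInt_ge_0; [lra|apply ex_RInt_gamma_fun; lra|].
            intros; left; apply gamma_fun_pos. }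
          unfold plus; simpl. lra. }
        unfold ball; simpl; unfold AbsRing_ball, abs, minus, plus, opp; simpl.
        apply Rabs_def1; destruct eps as [e He]; simpl in *; lra. }
  assert (HG : Gamma s = l).
  { unfold Gamma. apply is_RInt_gen_unique. exact HI. }
  rewrite HG. now split.
Qed.

(** Integration by parts. [F t = - t^s exp (- t)] tends to [0] at both ends: near [0] because
    [t^s <= t] for [t < 1], at infinity by [gamma_fun_le]. *)
Lemma Gamma_succ s : 1 <= s -> Gamma (s + 1) = s * Gamma s.
Proof.
  intros Hs.
  destruct (Gamma_spec s Hs) as [_ H0].
  destruct (Gamma_spec (s + 1)) as [_ H1]; [lra|].
  set (F := fun t => - gamma_fun (s + 1) t).
  assert (HD : forall t, 0 < t ->
     is_derive F t (gamma_fun (s + 1) t - s * gamma_fun s t)).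
  { intros t Ht. unfold F, gamma_fun, Rpower.
    replace (s + 1 - 1) with s by ring. auto_derive; [lra|].
    replace ((s - 1) * ln t) with (s * ln t + - ln t) by ring.
    rewrite (exp_plus (s * ln t)), (exp_Ropp (ln t)), exp_ln by lra.
    field; lra. }
  assert (Hpos : filter_prod (at_right 0) (Rbar_locally p_infty)
     (fun ab : R * R => forall x, Rmin (fst ab) (snd ab) <= x <= Rmax (fst ab) (snd ab) -> 0 < x)).
  { apply (Filter_prod _ _ _ (fun a => 0 < a) (fun b => 0 < b)).
    - exists (mkposreal 1 Rlt_0_1). easy.
    - now exists 0.
    - simpl. intros a b Ha Hb x Hx.
      apply Rlt_le_trans with (2 := proj1 Hx). now apply Rmin_glb_lt. }
  assert (HF : is_RInt_gen (Derive F) (at_right 0) (Rbar_locally p_infty) (0 - 0)).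
  { apply is_RInt_gen_Derive.
    - apply filter_imp with (2 := Hpos). intros ab H x Hx.
      eexists. apply HD, H, Hx.
    - apply filter_imp with (2 := Hpos). intros ab H x Hx.
      specialize (H x Hx).
      apply (continuous_ext_loc _ (fun t => gamma_fun (s + 1) t - s * gamma_fun s t)).
      + exists (mkposreal x H). intros y Hy.
        unfold ball in Hy; simpl in Hy; unfold AbsRing_ball, abs, minus, plus, opp in Hy; simpl in Hy.
        apply Rabs_def2 in Hy. symmetry. apply is_derive_unique, HD. lra.
      + apply (continuous_minus (V := R_NormedModule)).
        * now apply continuous_gamma_fun.
        * apply (continuous_scal_r (V := R_NormedModule)). now apply continuous_gamma_fun.
    - intros P [eps HP]. exists (mkposreal (Rmin 1 eps) (Rmin_pos _ _ Rlt_0_1 (cond_pos eps))).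
      intros y Hy Hy0. apply HP.
      unfold ball in *; simpl in *; unfold AbsRing_ball, abs, minus, plus, opp in *; simpl in *.
      apply Rabs_def2 in Hy. assert (y < 1 /\ y < eps) as [Hy1 Hy2].
      { split; apply Rlt_le_trans with (Rmin 1 eps); try lra; [apply Rmin_l|apply Rmin_r]. }
      unfold F. assert (Hg := gamma_fun_pos (s + 1) y).
      assert (gamma_fun (s + 1) y <= y).
      { unfold gamma_fun, Rpower. replace (s + 1 - 1) with s by ring.
        apply Rle_trans with (exp (ln y) * 1); [|rewrite exp_ln; lra].
        apply Rmult_le_compat; try (left; apply exp_pos).
        - apply exp_nondecreasing. assert (ln y < 0) by (rewrite <- ln_1; apply ln_increasing; lra). nra.
        - rewrite <- exp_0. apply exp_nondecreasing. lra. }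
      apply Rabs_def1; lra.
    - set (K := exp ((s + 1 - 1) * ln (2 * (s + 1)))).
      assert (HK : 0 < K) by apply exp_pos.
      intros P [eps HP]. destruct eps as [e He]; simpl in HP.
      (* The second bound is the solution of [K * exp (- y / 2) = e]. *)
      exists (Rmax 0 (- 2 * ln (e / K))). intros y Hy. apply HP.
      assert (0 < y) by (apply Rle_lt_trans with (2 := Hy); apply Rmax_l).
      assert (- 2 * ln (e / K) < y) by (apply Rle_lt_trans with (2 := Hy); apply Rmax_r).
      unfold ball; simpl; unfold AbsRing_ball, abs, minus, plus, opp; simpl.
      unfold F. assert (Hg := gamma_fun_pos (s + 1) y).
      assert (Hle : gamma_fun (s + 1) y <= K * exp (- y / 2)) by (apply gamma_fun_le; lra).
      assert (K * exp (- y / 2) < e).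
      { apply Rlt_le_trans with (K * exp (ln (e / K))).
        - apply Rmult_lt_compat_l; [easy|]. apply exp_increasing. lra.
        - rewrite exp_ln by (now apply Rdiv_lt_0_compat). right. field. lra. }
      apply Rabs_def1; lra. }
  assert (HS : is_RInt_gen (gamma_fun (s + 1)) (at_right 0) (Rbar_locally p_infty)
     (plus (0 - 0) (scal s (Gamma s) : R))).
  { apply (is_RInt_gen_ext (fun t => plus (Derive F t) (scal s (gamma_fun s t)))).
    - apply filter_imp with (2 := Hpos). intros ab H x Hx.
      rewrite (is_derive_unique _ _ _ (HD x (H x (conj (Rlt_le _ _ (proj1 Hx)) (Rlt_le _ _ (proj2 Hx)))))).
      unfold plus, scal; simpl; unfold mult; simpl. ring.
    - exact (is_RInt_gen_plus (V := R_NormedModule) (Derive F) _ _ _ HF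
        (is_RInt_gen_scal (V := R_NormedModule) (gamma_fun s) s _ H0)). }
  replace (Gamma (s + 1)) with (plus (0 - 0) (scal s (Gamma s) : R)).
  - unfold plus, scal; simpl; unfold mult; simpl. ring.
  - symmetry. unfold Gamma at 1. apply is_RInt_gen_unique. exact HS.
Qed.

(** * Finite sums and double series *)

Lemma is_series_is_lim_seq (a : nat -> R) (l : R) :
  is_series a l <-> is_lim_seq (sum_f_R0 a) l.
Proof.
  split; intros H.
  - apply is_lim_seq_ext with (sum_n a); [intros; apply sum_n_Reals|exact H].
  - change (is_lim_seq (sum_n a) l).
    apply is_lim_seq_ext with (sum_f_R0 a); [|exact H].
    intros; symmetry; apply sum_n_Reals.
Qed.

Lemma ex_series_le_R (a b : nat -> R) :
  (forall k, Rabs (a k) <= b k) -> ex_series b -> ex_series a.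
Proof. exact (ex_series_le (V := R_CompleteNormedModule) a b). Qed.

Lemma is_series_ext_R (a b : nat -> R) (l : R) :
  (forall k, a k = b k) -> is_series a l -> is_series b l.
Proof. exact (is_series_ext (V := R_NormedModule) a b l). Qed.

Lemma is_series_scal_R (c : R) (a : nat -> R) (l : R) :
  is_series a l -> is_series (fun k => c * a k) (c * l).
Proof. exact (is_series_scal (V := R_NormedModule) c a l). Qed.

Lemma sum_f_R0_zero (f : nat -> R) n :
  (forall k, (k <= n)%nat -> f k = 0) -> sum_f_R0 f n = 0.
Proof.
  induction n as [|n IH]; simpl; intros H; [now apply H|].
  rewrite IH, H; [ring|lia|]. intros; apply H; lia.
Qed.

Lemma is_series_zero : is_series (fun _ : nat => 0) 0.
Proof.
  apply is_series_is_lim_seq. apply is_lim_seq_ext with (fun _ => 0);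
    [intros; symmetry; now apply sum_f_R0_zero|apply is_lim_seq_const].
Qed.

Lemma sum_f_R0_scal (c : R) (f : nat -> R) n :
  sum_f_R0 (fun k => c * f k) n = c * sum_f_R0 f n.
Proof. rewrite scal_sum. apply sum_eq. intros; ring. Qed.

Lemma sum_f_R0_rev (f : nat -> R) n :
  sum_f_R0 (fun k => f (n - k)%nat) n = sum_f_R0 f n.
Proof.
  induction n as [|n IH]; [easy|].
  rewrite decomp_sum by lia. simpl Nat.pred. simpl (S n - 0)%nat.
  rewrite (sum_eq _ (fun k => f (n - k)%nat)) by (intros; f_equal; lia).
  rewrite IH. simpl. ring.
Qed.

Lemma sum_f_R0_triangle (X : nat -> nat -> R) P :
  sum_f_R0 (fun k => sum_f_R0 (X k) (P - k)) P =
  sum_f_R0 (fun K => sum_f_R0 (fun l => X (K - l)%nat l) K) P.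
Proof.
  induction P as [|P IH]; [easy|].
  rewrite (tech5 _ P), (tech5 (fun K => _) P), <- IH.
  replace (S P - S P)%nat with 0%nat by lia. simpl (sum_f_R0 (X (S P)) 0).
  rewrite (sum_eq (fun k => sum_f_R0 (X k) (S P - k))
    (fun k => sum_f_R0 (X k) (P - k) + X k (S P - k)%nat)).
  2:{ intros k Hk. replace (S P - k)%nat with (S (P - k)) by lia. easy. }
  rewrite plus_sum, Rplus_assoc. f_equal.
  rewrite <- (sum_f_R0_rev (fun l => X (S P - l)%nat l) (S P)), tech5.
  f_equal.
  - apply sum_eq. intros k Hk. f_equal; lia.
  - f_equal; lia.
Qed.

(** If [f] lists the coefficients of a power series in [r], these are its coefficients in [s] after
    [r = s^n]. *)
Definition gap (n : nat) (f : nat -> R) (N : nat) : R :=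
  if Nat.eqb (N mod n) 0 then f (N / n)%nat else 0.

Lemma sum_gap n f M : (0 < n)%nat ->
  sum_f_R0 (gap n f) M = sum_f_R0 f (M / n).
Proof.
  intros Hn. induction M as [|M IH].
  - unfold gap; simpl. rewrite Nat.Div0.mod_0_l, Nat.Div0.div_0_l. easy.
  - rewrite tech5, IH. unfold gap.
    assert (H1 := Nat.div_mod_eq M n). assert (H2 := Nat.div_mod_eq (S M) n).
    assert (H3 := Nat.mod_upper_bound M n). assert (H4 := Nat.mod_upper_bound (S M) n).
    destruct (Nat.eqb_spec (S M mod n) 0) as [H|H].
    + replace (S M / n)%nat with (S (M / n)) by nia. easy.
    + replace (S M / n)%nat with (M / n)%nat by nia. ring.
Qed.

Lemma is_series_gap n (f : nat -> R) (l : R) : (0 < n)%nat ->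
  is_series f l -> is_series (gap n f) l.
Proof.
  rewrite !is_series_is_lim_seq. intros Hn H.
  apply is_lim_seq_ext with (fun M => sum_f_R0 f (M / n)).
  { intros; symmetry; now apply sum_gap. }
  apply (filterlim_comp _ _ _ (fun M => M / n)%nat (sum_f_R0 f) _ eventually); [|exact H].
  intros P [N0 HN]. exists (N0 * n)%nat. intros M HM. apply HN.
  now apply Nat.div_le_lower_bound; [lia|rewrite Nat.mul_comm].
Qed.

Lemma is_series_ungap n (f : nat -> R) (l : R) : (0 < n)%nat ->
  is_series (gap n f) l -> is_series f l.
Proof.
  rewrite !is_series_is_lim_seq. intros Hn H.
  apply is_lim_seq_ext with (fun J => sum_f_R0 (gap n f) (J * n)).
  { intros J. rewrite sum_gap by easy. now rewrite Nat.div_mul by lia. }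
  apply (is_lim_seq_subseq (sum_f_R0 (gap n f)) l (fun J => J * n)%nat); [|exact H].
  apply eventually_subseq. intros; lia.
Qed.

(** Both sides run over the pairs [(N, k)] with [N + 2 k <= Q]. The pairs that appear in the
    induction step lie on [N + 2 k = S Q], and [gap 2] writes this diagonal as a sum over every
    [N <= S Q]. *)
Lemma sum_f_R0_shift_diagonals (a : nat -> nat -> R) Q :
  sum_f_R0 (fun P => sum_f_R0 (fun k => a (P - 2 * k)%nat k) (P / 2)) Q =
  sum_f_R0 (fun N => sum_f_R0 (a N) ((Q - N) / 2)) Q.
Proof.
  induction Q as [|Q IH]; [easy|].
  rewrite tech5, IH.
  transitivity (sum_f_R0 (fun N => sum_f_R0 (a N) ((Q - N) / 2)) Q +
    sum_f_R0 (fun N => gap 2 (a N) (S Q - N)) (S Q)).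
  - f_equal. rewrite <- (sum_f_R0_rev (fun N => gap 2 (a N) (S Q - N))).
    rewrite <- (sum_gap 2) by lia. apply sum_eq. intros k Hk.
    unfold gap. replace (S Q - (S Q - k))%nat with k by lia.
    destruct (Nat.eqb_spec (k mod 2) 0) as [H|H]; [|easy].
    f_equal. assert (H1 := Nat.div_mod_eq k 2). lia.
  - rewrite !(tech5 _ Q), <- Rplus_assoc, <- plus_sum. f_equal.
    + apply sum_eq. intros N HN.
      replace (S Q - N)%nat with (S (Q - N)) by lia.
      rewrite <- !(sum_gap 2) by lia. now rewrite tech5.
    + now rewrite Nat.sub_diag.
Qed.

Lemma Rabs_sum_f_R0_split_le (g B : nat -> R) n m : (n <= m)%nat ->
  (forall k, Rabs (g k) <= B k) ->
  Rabs (sum_f_R0 g m) <= sum_f_R0 (fun k => Rabs (g k)) n + (sum_f_R0 B m - sum_f_R0 B n).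
Proof.
  intros Hnm H. induction Hnm as [|m Hnm IH].
  - generalize (Rsum_abs g n). lra.
  - simpl. generalize (Rabs_triang (sum_f_R0 g m) (g (S m))) (H (S m)). lra.
Qed.

(* Tannery's theorem. *)
Lemma is_lim_seq_dominated_sum (f : nat -> nat -> R) (B : nat -> R) :
  ex_series B -> (forall Q N, Rabs (f Q N) <= B N) ->
  (forall N, is_lim_seq (fun Q => f Q N) 0) ->
  is_lim_seq (fun Q => sum_f_R0 (f Q) Q) 0.
Proof.
  intros [b Hb] Hle Hlim. apply is_series_is_lim_seq in Hb.
  apply is_lim_seq_spec. intros eps.
  assert (He : 0 < eps / 4) by (destruct eps; simpl; lra).
  apply is_lim_seq_spec in Hb. destruct (Hb (mkposreal _ He)) as [N0 HN0]; simpl in HN0.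
  assert (Hfin : is_lim_seq (fun Q => sum_f_R0 (fun N => Rabs (f Q N)) N0) 0).
  { clear HN0. induction N0 as [|N0 IH]; simpl.
    - apply (proj1 (is_lim_seq_abs_0 _)), Hlim.
    - replace (Finite 0) with (Finite (0 + 0)) by (f_equal; ring).
      apply is_lim_seq_plus'; [exact IH|]. apply (proj1 (is_lim_seq_abs_0 _)), Hlim. }
  apply is_lim_seq_spec in Hfin. destruct (Hfin (mkposreal _ He)) as [Q0 HQ0]; simpl in HQ0.
  exists (max N0 Q0). intros Q HQ.
  assert (H1 := HN0 N0 (Nat.le_refl _)). assert (H2 := HN0 Q ltac:(lia)).
  assert (H3 := HQ0 Q ltac:(lia)).
  assert (H4 := Rabs_sum_f_R0_split_le (f Q) B N0 Q ltac:(lia) (Hle Q)).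
  apply Rabs_def2 in H1. apply Rabs_def2 in H2. apply Rabs_def2 in H3.
  rewrite Rminus_0_r. lra.
Qed.

(** Rearrangement of an absolutely convergent double series. A partial sum over diagonals is a
    partial sum of the row sums [S N] plus truncation errors of the rows; each error tends to [0]
    and is dominated by [2 * Ba N], so Tannery's theorem applies. *)
Lemma is_series_diagonals (a : nat -> nat -> R) (S Ba : nat -> R) (l : R) :
  (forall N, is_series (a N) (S N)) ->
  (forall N, is_series (fun k => Rabs (a N k)) (Ba N)) ->
  ex_series Ba -> is_series S l ->
  is_series (fun P => sum_f_R0 (fun k => a (P - 2 * k)%nat k) (P / 2)) l.
Proof.
  intros Ha HBa HB HS.
  assert (Hpart : forall N n, sum_f_R0 (fun k => Rabs (a N k)) n <= Ba N).
  { intros N n. apply (sum_incr _ n); [|intros; apply Rabs_pos].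
    apply is_series_Reals, HBa. }
  assert (HSB : forall N, Rabs (S N) <= Ba N).
  { intros N. change (Rbar_le (Rabs (S N)) (Ba N)).
    apply is_lim_seq_le with (fun n => Rabs (sum_f_R0 (a N) n)) (fun _ => Ba N).
    - intros n. eapply Rle_trans; [apply Rsum_abs|apply Hpart].
    - apply (is_lim_seq_abs _ (S N)). now apply is_series_is_lim_seq.
    - apply is_lim_seq_const. }
  apply is_series_is_lim_seq.
  apply is_lim_seq_ext with (fun Q =>
    sum_f_R0 S Q + sum_f_R0 (fun N => if Nat.leb N Q then
       sum_f_R0 (a N) ((Q - N) / 2) - S N else 0) Q).
  { intros Q. rewrite sum_f_R0_shift_diagonals, <- plus_sum.
    apply sum_eq. intros N HN. apply Nat.leb_le in HN. rewrite HN. ring. }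
  replace l with (l + 0) by ring. apply is_lim_seq_plus'.
  { now apply is_series_is_lim_seq. }
  apply (is_lim_seq_dominated_sum _ (fun N => 2 * Ba N)).
  - destruct HB as [b Hb]. exists (2 * b). now apply is_series_scal_R.
  - intros Q N.
    assert (0 <= Ba N) by (eapply Rle_trans; [apply Rabs_pos|apply HSB]).
    destruct (Nat.leb N Q).
    + assert (H1 := Rabs_triang (sum_f_R0 (a N) ((Q - N) / 2)) (- S N)).
      rewrite Rabs_Ropp in H1. unfold Rminus.
      assert (H2 := Rsum_abs (a N) ((Q - N) / 2)). assert (H3 := Hpart N ((Q - N) / 2)%nat).
      assert (H4 := HSB N). lra.
    + rewrite Rabs_R0. lra.
  - intros N.
    apply is_lim_seq_ext_loc with (fun Q => sum_f_R0 (a N) ((Q - N) / 2) - S N).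
    { exists N. intros Q HQ. apply Nat.leb_le in HQ. now rewrite HQ. }
    replace (Finite 0) with (Finite (S N - S N)) by (f_equal; ring).
    apply is_lim_seq_minus'; [|apply is_lim_seq_const].
    apply (filterlim_comp _ _ _ (fun Q => (Q - N) / 2)%nat (sum_f_R0 (a N)) _ eventually).
    + intros P [N0 HN0]. exists (N + N0 * 2)%nat. intros Q HQ. apply HN0.
      apply Nat.div_le_lower_bound; lia.
    + apply (proj1 (is_series_is_lim_seq (a N) (S N))), Ha.
Qed.

(** * Generating functions *)

Lemma geometric_bound_CV_radius (a : nat -> R) K x :
  0 < K -> (forall n, Rabs (a n) <= K ^ n) -> Rabs x < / K ->
  Rbar_lt (Rabs x) (CV_radius a).
Proof.
  intros HK Ha Hx. apply Rbar_lt_le_trans with (/ K); [exact Hx|].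
  apply (proj1 (CV_radius_bounded a)). exists 1. intros n.
  rewrite Rabs_mult, <- RPow_abs, (Rabs_pos_eq (/ K)) by (left; now apply Rinv_0_lt_compat).
  replace 1 with (K ^ n * (/ K) ^ n) by (rewrite <- Rpow_mult_distr, Rinv_r, pow1; lra).
  apply Rmult_le_compat_r; [|apply Ha].
  apply pow_le; left; now apply Rinv_0_lt_compat.
Qed.

Lemma ex_pseries_CV_radius (a : nat -> R) x :
  ex_pseries a x -> Rbar_le (Rabs x) (CV_radius a).
Proof.
  intros H. apply Rbar_not_lt_le. intros Hlt. apply (CV_disk_outside _ _ Hlt).
  apply ex_series_lim_0. now apply ex_pseries_R.
Qed.

(* The recurrence says that the sum f of the power series solves q f' = - lam q' f,
   with q x = 1 - 2 c x + d x^2. *)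
Lemma quadratic_generating_function (a : nat -> R) (c d lam rho : R) :
  a 0%nat = 1 -> a 1%nat = 2 * lam * c ->
  (forall j, INR (S (S j)) * a (S (S j)) =
     2 * c * (INR (S j) + lam) * a (S j) - d * (INR (S j) + 2 * lam - 1) * a j) ->
  (forall x, Rabs x < rho -> Rbar_lt (Rabs x) (CV_radius a)) ->
  (forall x, Rabs x < rho -> 0 < 1 - 2 * c * x + d * x ^ 2) ->
  forall x, Rabs x < rho ->
  PSeries a x = exp (- lam * ln (1 - 2 * c * x + d * x ^ 2)).
Proof.
  intros H0 H1 Hrec Hrad Hq x Hx.
  set (q := fun t => 1 - 2 * c * t + d * t ^ 2) in *.
  assert (Hode : forall t, Rabs t < rho ->
     q t * PSeries (PS_derive a) t = lam * (2 * c - 2 * d * t) * PSeries a t).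
  { intros t Ht.
    assert (Pa := PSeries_correct _ _ (CV_radius_inside _ _ (Hrad t Ht))).
    assert (Pd : is_pseries (PS_derive a) t (PSeries (PS_derive a) t)).
    { apply PSeries_correct, CV_radius_inside. rewrite CV_radius_derive. now apply Hrad. }
    assert (Pd1 := is_pseries_incr_1 _ _ _ Pd). assert (Pd2 := is_pseries_incr_1 _ _ _ Pd1).
    assert (Pa1 := is_pseries_incr_1 _ _ _ Pa).
    apply is_pseries_R in Pa, Pd, Pa1, Pd1, Pd2.
    assert (Hz := is_series_plus _ _ _ _ Pd
      (is_series_plus _ _ _ _ (is_series_scal_R (- 2 * c) _ _ Pd1)
      (is_series_plus _ _ _ _ (is_series_scal_R d _ _ Pd2)
      (is_series_plus _ _ _ _ (is_series_scal_R (- 2 * lam * c) _ _ Pa)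
         (is_series_scal_R (2 * lam * d) _ _ Pa1))))).
    apply (is_series_ext_R _ (fun _ => 0)) in Hz.
    - apply is_series_unique in Hz. rewrite (is_series_unique _ _ is_series_zero) in Hz.
      unfold q. unfold plus, scal in Hz; simpl in Hz. unfold mult in Hz; simpl in Hz. lra.
    - intros n. unfold plus; simpl. unfold PS_incr_1, PS_derive.
      destruct n as [|[|n]].
      + rewrite H0, H1. unfold zero; simpl. ring.
      + specialize (Hrec 0%nat). rewrite Hrec. unfold zero; simpl. rewrite H0. ring.
      + specialize (Hrec (S n)). rewrite Hrec. rewrite !S_INR. ring. }
  (* This is [f q^lam]; the differential equation makes its derivative vanish, so it keeps its value
     [1] at the origin. *)
  set (phi := fun t => PSeries a t * exp (lam * ln (q t))).
  assert (Hphi : forall t, Rabs t < rho -> is_derive phi t zero).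
  { intros t Ht. unfold phi.
    assert (D1 : is_derive (fun t => exp (lam * ln (q t))) t
       (lam * ((- 2 * c + 2 * d * t) / q t) * exp (lam * ln (q t)))).
    { assert (Dq : is_derive q t (- 2 * c + 2 * d * t)) by (unfold q; auto_derive; [easy|ring]).
      assert (Hqt := Hq t Ht). fold (q t) in Hqt. clearbody q.
      auto_derive; [split; [eexists; exact Dq|easy]|].
      change (Derive (fun u : R => q u) t) with (Derive q t).
      rewrite (is_derive_unique q t _ Dq). field. lra. }
    evar_last.
    - apply (is_derive_mult (K := R_AbsRing) (PSeries a) (fun t => exp (lam * ln (q t))) t _ _
        (is_derive_PSeries _ _ (Hrad t Ht)) D1). intros; apply Rmult_comm.
    - unfold plus, mult, zero; simpl. specialize (Hode t Ht). assert (Hqt := Hq t Ht).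
      fold (q t) in Hqt.
      replace (PSeries (PS_derive a) t) with (lam * (2 * c - 2 * d * t) * PSeries a t / q t).
      + field. lra.
      + rewrite <- Hode. field. lra. }
  assert (Hc : phi x = 1).
  { transitivity (phi 0).
    - destruct (Rtotal_order x 0) as [Hn|[->|Hp]]; [|easy|].
      + apply (eq_is_derive (V := R_NormedModule) phi); [|easy]. intros t Ht. apply Hphi.
        rewrite Rabs_left1 by lra. rewrite Rabs_left in Hx by lra. lra.
      + symmetry. apply (eq_is_derive (V := R_NormedModule) phi); [|easy]. intros t Ht. apply Hphi.
        rewrite Rabs_pos_eq by lra. rewrite Rabs_pos_eq in Hx by lra. lra.
    - unfold phi, q. rewrite PSeries_0, H0.
      replace (1 - 2 * c * 0 + d * 0 ^ 2) with 1 by ring. rewrite ln_1, Rmult_0_r, exp_0. ring. }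
  unfold phi in Hc. fold (q x).
  replace (- lam * ln (q x)) with (- (lam * ln (q x))) by ring. rewrite exp_Ropp.
  assert (He := exp_pos (lam * ln (q x))).
  apply Rmult_eq_reg_r with (exp (lam * ln (q x))); [|lra]. rewrite Hc. field. lra.
Qed.

(** * Pochhammer symbols and the binomial series *)

Fixpoint poch (a : R) (k : nat) : R :=
  match k with O => 1 | S k' => poch a k' * (a + INR k') end.

(** The coefficient of [x^k] in [(1 - x)^(- a)]. *)
Definition bc (a : R) (k : nat) : R := poch a k / INR (fact k).

Lemma poch_S a k : poch a (S k) = poch a k * (a + INR k).
Proof. reflexivity. Qed.

Lemma poch_pos a k : 0 < a -> 0 < poch a k.
Proof.
  intros Ha. induction k as [|k IH]; simpl; [lra|].
  apply Rmult_lt_0_compat; [easy|]. generalize (pos_INR k). lra.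
Qed.

Lemma poch_add a j k : poch a (j + k) = poch a j * poch (a + INR j) k.
Proof.
  induction k as [|k IH]; [rewrite Nat.add_0_r; simpl; ring|].
  rewrite Nat.add_succ_r; simpl. rewrite IH, plus_INR. ring.
Qed.

Lemma bc_pos a k : 0 < a -> 0 < bc a k.
Proof. intros; apply Rdiv_lt_0_compat; [now apply poch_pos|apply INR_fact_lt_0]. Qed.

Lemma bc_S a k : INR (S k) * bc a (S k) = (a + INR k) * bc a k.
Proof.
  unfold bc. rewrite fact_simpl, mult_INR. simpl poch. field.
  split; [apply INR_fact_neq_0|apply not_0_INR; lia].
Qed.

Lemma bc_le_pow a k : 0 < a -> bc a k <= (1 + a) ^ k.
Proof.
  intros Ha. induction k as [|k IH]; [unfold bc; simpl; lra|].
  assert (H := bc_S a k). assert (Hb := bc_pos a k Ha). assert (Hk := pos_INR k).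
  rewrite S_INR in H.
  apply Rle_trans with ((1 + a) * bc a k).
  - apply Rmult_le_reg_l with (INR k + 1); [lra|]. rewrite H.
    assert (0 <= INR k * a) by (apply Rmult_le_pos; lra).
    assert (0 <= INR k * a * bc a k) by (apply Rmult_le_pos; lra). lra.
  - simpl. apply Rmult_le_compat_l; lra.
Qed.

Lemma CV_radius_bc a : 0 < a -> CV_radius (bc a) = 1.
Proof.
  intros Ha. replace (Finite 1) with (Finite (/ 1)) by (f_equal; field).
  apply CV_radius_finite_DAlembert; [|lra|].
  - intros k. generalize (bc_pos a k Ha). lra.
  - apply is_lim_seq_ext with (fun k => 1 + (a - 1) * / (INR k + 1)).
    { intros k. assert (Hk := pos_INR k). assert (Hb := bc_pos a k Ha).
      assert (Hb' := bc_pos a (S k) Ha).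
      rewrite Rabs_pos_eq by (left; now apply Rdiv_lt_0_compat).
      assert (H := bc_S a k). rewrite S_INR in H.
      replace (bc a (S k)) with ((a + INR k) * bc a k / (INR k + 1)) by (rewrite <- H; field; lra).
      field. lra. }
    replace (Finite 1) with (Finite (1 + (a - 1) * 0)) by (f_equal; ring).
    apply is_lim_seq_plus'; [apply is_lim_seq_const|].
    apply is_lim_seq_mult'; [apply is_lim_seq_const|].
    apply (is_lim_seq_inv _ p_infty); [|easy].
    apply is_lim_seq_ext with (fun k => INR (S k)); [intros; apply S_INR|].
    apply (is_lim_seq_incr_1 INR). apply is_lim_seq_INR.
Qed.

Lemma PSeries_bc a x : 0 < a -> Rabs x < 1 -> PSeries (bc a) x = exp (- a * ln (1 - x)).
Proof.
  intros Ha Hx.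
  (* With [c = 1 / 2] and [d = 0] the quadratic degenerates to [1 - x]. *)
  rewrite (quadratic_generating_function (bc a) (1 / 2) 0 a 1); [| | | | | |exact Hx].
  - do 3 f_equal. field.
  - unfold bc; simpl; field.
  - unfold bc; simpl; field.
  - intros j. rewrite bc_S. field.
  - intros t Ht. rewrite CV_radius_bc; easy.
  - intros t Ht. apply Rabs_def2 in Ht. lra.
Qed.

Lemma is_series_bc a x : 0 < a -> Rabs x < 1 ->
  is_series (fun k => bc a k * x ^ k) (exp (- a * ln (1 - x))).
Proof.
  intros Ha Hx. rewrite <- PSeries_bc by easy. apply is_pseries_R.
  apply PSeries_correct, CV_radius_inside. now rewrite CV_radius_bc.
Qed.

(** * The generating function of the Gegenbauer polynomials *)

Lemma Gegenbauer_rec lam x j :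
  INR (S (S j)) * Gegenbauer lam (S (S j)) x =
  2 * x * (INR (S j) + lam) * Gegenbauer lam (S j) x
  - (INR (S j) + 2 * lam - 1) * Gegenbauer lam j x.
Proof.
  assert (Hsnd : forall i, snd (geg_pair lam x i) = Gegenbauer lam (S i) x).
  { intros i. unfold Gegenbauer. simpl. now destruct (geg_pair lam x i). }
  rewrite <- (Hsnd (S j)), <- (Hsnd j).
  unfold Gegenbauer. cbn [geg_pair]. destruct (geg_pair lam x j) as [c0 c1]. cbn [fst snd].
  rewrite (S_INR (S j)). field. generalize (pos_INR (S j)). lra.
Qed.

(** A crude growth rate that secures a positive radius of convergence. The recurrence preserves it
    because [2 * (y + lam) * K + (y + 2 * lam) <= (y + 1) * K^2] for [K = 3 + 2 * lam]. *)
Lemma Gegenbauer_bound lam x j : 0 <= lam -> Rabs x <= 1 ->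
  Rabs (Gegenbauer lam j x) <= (3 + 2 * lam) ^ j.
Proof.
  intros Hl Hx. set (K := 3 + 2 * lam).
  cut (Rabs (Gegenbauer lam j x) <= K ^ j /\ Rabs (Gegenbauer lam (S j) x) <= K ^ S j); [easy|].
  induction j as [|j [IH0 IH1]].
  - unfold Gegenbauer; simpl. rewrite Rabs_R1. split; [lra|].
    rewrite !Rabs_mult, (Rabs_pos_eq 2), (Rabs_pos_eq lam) by lra. unfold K.
    assert (lam * Rabs x <= lam * 1) by (apply Rmult_le_compat_l; lra). lra.
  - split; [easy|].
    assert (Hj := pos_INR (S j)). assert (HR := Gegenbauer_rec lam x j).
    apply Rmult_le_reg_l with (INR (S (S j))); [apply lt_0_INR; lia|].
    rewrite <- (Rabs_pos_eq (INR (S (S j)))) at 1 by apply pos_INR.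
    rewrite <- Rabs_mult, HR, (S_INR (S j)).
    set (y := INR (S j)) in *.
    assert (Hy : 1 <= y) by (unfold y; rewrite S_INR; generalize (pos_INR j); lra).
    apply Rle_trans with (2 * 1 * (y + lam) * K ^ S j + (y + 2 * lam) * K ^ j).
    + unfold Rminus at 1. eapply Rle_trans; [apply Rabs_triang|]. rewrite Rabs_Ropp, !Rabs_mult.
      rewrite (Rabs_pos_eq 2), (Rabs_pos_eq (y + lam)), (Rabs_pos_eq (y + 2 * lam - 1)) by lra.
      apply Rplus_le_compat.
      * apply Rmult_le_compat; [|apply Rabs_pos| |easy].
        { repeat apply Rmult_le_pos; try lra. apply Rabs_pos. }
        apply Rmult_le_compat_r; [lra|]. apply Rmult_le_compat_l; lra.
      * apply Rmult_le_compat; [lra|apply Rabs_pos|lra|easy].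
    + simpl. assert (HK : 0 < K ^ j) by (apply pow_lt; unfold K; lra).
      set (k := K ^ j) in *.
      replace ((y + 1) * (K * (K * k))) with ((y + 1) * (K * K) * k) by ring.
      replace (2 * 1 * (y + lam) * (K * k) + (y + 2 * lam) * k)
        with ((2 * (y + lam) * K + (y + 2 * lam)) * k) by ring.
      apply Rmult_le_compat_r; [lra|]. unfold K. nra.
Qed.

Lemma is_series_Gegenbauer lam xi x : 0 <= lam -> Rabs xi <= 1 -> Rabs x < / (3 + 2 * lam) ->
  is_series (fun j => Gegenbauer lam j xi * x ^ j)
    (exp (- lam * ln (1 - 2 * xi * x + x ^ 2))).
Proof.
  intros Hl Hxi Hx.
  assert (Hrad : forall t, Rabs t < / (3 + 2 * lam) ->
    Rbar_lt (Rabs t) (CV_radius (fun j => Gegenbauer lam j xi))).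
  { intros t Ht. apply geometric_bound_CV_radius with (3 + 2 * lam); [lra| |easy].
    intros; now apply Gegenbauer_bound. }
  rewrite <- (Rmult_1_l (x ^ 2)).
  rewrite <- (quadratic_generating_function (fun j => Gegenbauer lam j xi) xi 1 lam (/ (3 + 2 * lam)));
    [| | | | | |easy].
  - apply is_pseries_R, PSeries_correct, CV_radius_inside, Hrad, Hx.
  - reflexivity.
  - unfold Gegenbauer; simpl; ring.
  - intros j. rewrite Gegenbauer_rec. ring.
  - exact Hrad.
  (* Within this radius [Rabs t < 1 / 3], which also keeps the quadratic positive. *)
  - intros t Ht. assert (/ (3 + 2 * lam) <= / 3) by (apply Rinv_le_contravar; lra).
    assert (Ht3 : Rabs t < / 3) by lra.
    assert (Hm : Rabs (xi * t) <= Rabs t).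
    { rewrite Rabs_mult. rewrite <- (Rmult_1_l (Rabs t)) at 2.
      apply Rmult_le_compat_r; [apply Rabs_pos|easy]. }
    assert (xi * t < / 3) by (apply Rle_lt_trans with (2 := Ht3);
      apply Rle_trans with (2 := Hm); apply Rle_abs).
    generalize (pow2_ge_0 t). lra.
Qed.

(** * Products of binomial series *)

Fixpoint prodn (f : nat -> R) (n : nat) : R :=
  match n with O => 1 | S n' => prodn f n' * f n' end.

Lemma prodn_ext f g n : (forall k, f k = g k) -> prodn f n = prodn g n.
Proof. intros H. induction n as [|n IH]; simpl; [easy|]. now rewrite IH, H. Qed.

Lemma prodn_pos f n : (forall k, 0 < f k) -> 0 < prodn f n.
Proof. intros H. induction n as [|n IH]; simpl; [lra|]. now apply Rmult_lt_0_compat. Qed.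

Lemma prodn_scal u f n : prodn (fun k => u * f k) n = u ^ n * prodn f n.
Proof. induction n as [|n IH]; simpl; [ring|]. rewrite IH. ring. Qed.

(* Coefficients of [prod_(k < n) (1 - c_k r)^(-lam)] as a power series in [r]. *)
Fixpoint hconv (lam : R) (c : nat -> R) (n : nat) : nat -> R :=
  match n with
  | O => fun p => match p with O => 1 | S _ => 0 end
  | S n' => PS_mult (hconv lam c n') (fun q => bc lam q * c n' ^ q)
  end.

Lemma hconv_0 lam c n : hconv lam c n 0 = 1.
Proof.
  induction n as [|n IH]; [easy|]. simpl. unfold PS_mult; simpl. rewrite IH.
  unfold bc; simpl. field.
Qed.

Lemma INR_S_le_pow2 n : INR (S n) <= 2 ^ n.
Proof.
  induction n as [|n IH]; [simpl; lra|]. rewrite S_INR. change (2 ^ S n) with (2 * 2 ^ n).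
  assert (1 <= 2 ^ n) by (apply pow_R1_Rle; lra). lra.
Qed.

(** The coefficient has [p + 1] terms of size at most [K^p], and [p + 1 <= 2^p]. *)
Lemma PS_mult_geometric_bound (a b : nat -> R) K : 0 < K ->
  (forall p, Rabs (a p) <= K ^ p) -> (forall p, Rabs (b p) <= K ^ p) ->
  forall p, Rabs (PS_mult a b p) <= (2 * K) ^ p.
Proof.
  intros HK Ha Hb p. unfold PS_mult.
  apply Rle_trans with (sum_f_R0 (fun _ => K ^ p) p).
  - eapply Rle_trans; [apply Rsum_abs|]. apply sum_Rle. intros k Hk.
    rewrite Rabs_mult. replace p with (k + (p - k))%nat at 2 by lia. rewrite pow_add.
    apply Rmult_le_compat; try apply Rabs_pos; easy.
  - rewrite sum_cte, Rpow_mult_distr, Rmult_comm. apply Rmult_le_compat_r.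
    + apply pow_le; lra.
    + apply INR_S_le_pow2.
Qed.

Lemma bc_pow_bound lam c q : 0 < lam -> Rabs c <= 1 -> Rabs (bc lam q * c ^ q) <= (1 + lam) ^ q.
Proof.
  intros Hl Hc. rewrite Rabs_mult, <- RPow_abs, Rabs_pos_eq by (left; now apply bc_pos).
  rewrite <- (Rmult_1_r ((1 + lam) ^ q)). apply Rmult_le_compat.
  - left; now apply bc_pos.
  - apply pow_le, Rabs_pos.
  - now apply bc_le_pow.
  - rewrite <- (pow1 q). apply pow_incr. split; [apply Rabs_pos|easy].
Qed.

Lemma Rabs_mult_lt_1 c r : Rabs c <= 1 -> Rabs r < 1 -> Rabs (c * r) < 1.
Proof.
  intros Hc Hr. rewrite Rabs_mult. assert (H1 := Rabs_pos c). assert (H2 := Rabs_pos r).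
  apply Rle_lt_trans with (1 * Rabs r); [|lra]. apply Rmult_le_compat_r; lra.
Qed.

Lemma one_minus_mult_pos c r : Rabs c <= 1 -> Rabs r < 1 -> 0 < 1 - c * r.
Proof. intros Hc Hr. generalize (Rabs_def2 _ _ (Rabs_mult_lt_1 c r Hc Hr)). lra. Qed.

(** [K] at least doubles with each factor, so it is left existential. Coefficients are compared
    through the germ at [0], for which any positive radius is enough. *)
Lemma hconv_generating_function lam c n : 0 < lam -> (forall k, Rabs (c k) <= 1) ->
  exists K, 1 <= K /\ (forall p, Rabs (hconv lam c n p) <= K ^ p) /\
    forall r, Rabs r < / K ->
    is_series (fun p => hconv lam c n p * r ^ p)
      (exp (- lam * ln (prodn (fun k => 1 - c k * r) n))).
Proof.
  intros Hl Hc. induction n as [|n (K & HK1 & HKb & HKs)].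
  - exists 1. split; [lra|]. split.
    + intros [|p]; simpl; rewrite ?Rabs_R1, ?Rabs_R0; [lra|]. rewrite pow1; lra.
    + intros r _. simpl. rewrite ln_1, Rmult_0_r, exp_0.
      apply is_series_is_lim_seq. apply is_lim_seq_ext with (fun _ => 1).
      * intros n. induction n as [|n IH]; simpl; [ring|]. rewrite <- IH. ring.
      * apply is_lim_seq_const.
  - set (K' := Rmax K (1 + lam)).
    assert (HKK' : K <= K') by apply Rmax_l. assert (HlK' : 1 + lam <= K') by apply Rmax_r.
    set (b := fun q => bc lam q * c n ^ q).
    assert (Ha' : forall p, Rabs (hconv lam c n p) <= K' ^ p).
    { intros p. eapply Rle_trans; [apply HKb|]. apply pow_incr. lra. }
    assert (Hb' : forall p, Rabs (b p) <= K' ^ p).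
    { intros p. eapply Rle_trans; [now apply bc_pow_bound|]. apply pow_incr. lra. }
    exists (2 * K'). split; [lra|]. split.
    + simpl. now apply PS_mult_geometric_bound; [lra| |].
    + intros r Hr.
      assert (HrK' : Rabs r < / K').
      { apply Rlt_trans with (1 := Hr). apply Rinv_lt_contravar; [nra|lra]. }
      assert (HrK : Rabs r < / K).
      { apply Rlt_le_trans with (1 := HrK'). apply Rinv_le_contravar; lra. }
      assert (Hr1 : Rabs r < 1).
      { apply Rlt_le_trans with (1 := HrK). rewrite <- Rinv_1. apply Rinv_le_contravar; lra. }
      simpl prodn. rewrite ln_mult.
      2:{ apply prodn_pos. intros; now apply one_minus_mult_pos. }
      2:{ now apply one_minus_mult_pos. }
      rewrite Rmult_plus_distr_l, exp_plus. apply is_pseries_R.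
      apply is_pseries_mult.
      * apply is_pseries_R. now apply HKs.
      * apply is_pseries_R.
        apply (is_series_ext_R (fun q => bc lam q * (c n * r) ^ q)).
        -- intros q. rewrite Rpow_mult_distr. unfold b. ring.
        -- apply is_series_bc; [easy|]. now apply Rabs_mult_lt_1.
      * apply geometric_bound_CV_radius with K'; [lra| |]; easy.
      * apply geometric_bound_CV_radius with K'; [lra| |]; easy.
Qed.

Lemma gap_mult_pow n (f : nat -> R) s N : (0 < n)%nat ->
  gap n f N * s ^ N = gap n (fun j => f j * (s ^ n) ^ j) N.
Proof.
  intros Hn. unfold gap. destruct (Nat.eqb_spec (N mod n) 0) as [H|H]; [|apply Rmult_0_l].
  rewrite <- pow_mult. do 2 f_equal. assert (H1 := Nat.div_mod_eq N n). lia.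
Qed.

(* Both sides are the coefficients of [(1 - 2 xi s^n + s^(2n))^(-lam)]: the right-hand
   side arises from [prod_k (1 - 2 c_k s + s^2) = (1 + s^2)^n prod_k (1 - c_k r)] with
   [r = 2 s / (1 + s^2)]. *)
Lemma Gegenbauer_hconv lam c n xi : 0 < lam -> (0 < n)%nat -> (forall k, Rabs (c k) <= 1) ->
  Rabs xi <= 1 ->
  (forall s, prodn (fun k => 1 - 2 * c k * s + s ^ 2) n = 1 - 2 * xi * s ^ n + (s ^ n) ^ 2) ->
  forall N, gap n (fun j => Gegenbauer lam j xi) N =
  sum_f_R0 (fun k => (2 ^ (N - 2 * k) * hconv lam c n (N - 2 * k)) *
     ((-1) ^ k * bc (INR n * lam + INR (N - 2 * k)) k)) (N / 2).
Proof.
  intros Hl Hn Hc Hxi Hprod N. set (nu := INR n * lam).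
  assert (Hnu : 0 < nu) by (apply Rmult_lt_0_compat; [apply lt_0_INR; lia|easy]).
  destruct (hconv_generating_function lam c n Hl Hc) as (K & HK1 & HKb & HKs).
  set (h := hconv lam c n) in *.
  set (D := fun N => sum_f_R0 (fun k => (2 ^ (N - 2 * k) * h (N - 2 * k)%nat) *
     ((-1) ^ k * bc (nu + INR (N - 2 * k)) k)) (N / 2)).
  (* The first bound puts [r = 2 s / (1 + s^2)] inside the radius [/ K] and makes [s^2 < 1 / 16];
     the second is the radius for the Gegenbauer series. *)
  set (delta := Rmin (/ (4 * K)) (/ (3 + 2 * lam))).
  assert (Hd : 0 < delta) by (apply Rmin_pos; apply Rinv_0_lt_compat; lra).
  assert (HL : forall s, Rabs s < delta ->
    is_series (fun N => gap n (fun j => Gegenbauer lam j xi) N * s ^ N)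
      (exp (- lam * ln (1 - 2 * xi * s ^ n + (s ^ n) ^ 2)))).
  { intros s Hs. assert (Hs3 : Rabs s < / (3 + 2 * lam)).
    { apply Rlt_le_trans with (1 := Hs). apply Rmin_r. }
    apply (is_series_ext_R (gap n (fun j => Gegenbauer lam j xi * (s ^ n) ^ j))).
    { intros; symmetry; now apply gap_mult_pow. }
    apply is_series_gap; [easy|]. apply is_series_Gegenbauer; [lra|easy|].
    apply Rle_lt_trans with (2 := Hs3). rewrite <- RPow_abs.
    destruct n as [|n']; [lia|]. simpl. apply Rle_trans with (Rabs s * 1); [|lra].
    apply Rmult_le_compat_l; [apply Rabs_pos|]. rewrite <- (pow1 n'). apply pow_incr.
    split; [apply Rabs_pos|]. assert (/ (3 + 2 * lam) <= / 1) by (apply Rinv_le_contravar; lra).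
    lra. }
  assert (HR : forall s, Rabs s < delta ->
    is_series (fun N => D N * s ^ N)
      (exp (- lam * ln (1 - 2 * xi * s ^ n + (s ^ n) ^ 2)))).
  { intros s Hs. assert (Hs4 : Rabs s < / (4 * K)).
    { apply Rlt_le_trans with (1 := Hs). apply Rmin_l. }
    assert (Hs1 : Rabs s < / 4).
    { apply Rlt_le_trans with (1 := Hs4). apply Rinv_le_contravar; lra. }
    assert (Hss : 0 <= s ^ 2 < / 16).
    { split; [apply pow2_ge_0|]. rewrite <- pow2_abs. generalize (Rabs_pos s). simpl. nra. }
    (* The term [(1 + s^2)^(- nu) * h p * r^p] equals [2^p * h p * s^p * (1 + s^2)^(- (nu + p))];
       row [p] of [a] is its binomial expansion in [- s^2]. *)
    set (a := fun p k => (2 ^ p * h p) * ((-1) ^ k * bc (nu + INR p) k) * s ^ (p + 2 * k)).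
    assert (Hnp : forall p, 0 < nu + INR p) by (intros p; generalize (pos_INR p); lra).
    assert (Ha : forall p, is_series (a p)
      (2 ^ p * h p * s ^ p * exp (- (nu + INR p) * ln (1 + s ^ 2)))).
    { intros p.
      apply (is_series_ext_R (fun k => 2 ^ p * h p * s ^ p * (bc (nu + INR p) k * (- s ^ 2) ^ k))).
      - intros k. unfold a. rewrite pow_add, pow_mult.
        replace (- s ^ 2) with (-1 * s ^ 2) by ring. rewrite Rpow_mult_distr. ring.
      - apply is_series_scal_R. replace (1 + s ^ 2) with (1 - - s ^ 2) by ring.
        apply is_series_bc; [easy|]. rewrite Rabs_Ropp, Rabs_pos_eq; lra. }
    assert (HBa : forall p, is_series (fun k => Rabs (a p k))
      (Rabs (2 ^ p * h p * s ^ p) * exp (- (nu + INR p) * ln (1 - s ^ 2)))).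
    { intros p.
      apply (is_series_ext_R (fun k => Rabs (2 ^ p * h p * s ^ p) * (bc (nu + INR p) k * (s ^ 2) ^ k))).
      - intros k. unfold a. rewrite pow_add, pow_mult.
        replace ((2 ^ p * h p) * ((-1) ^ k * bc (nu + INR p) k) * (s ^ p * (s ^ 2) ^ k)) with
          ((2 ^ p * h p * s ^ p) * (-1) ^ k * (bc (nu + INR p) k * (s ^ 2) ^ k)) by ring.
        rewrite !Rabs_mult, pow_1_abs, (Rabs_pos_eq (bc (nu + INR p) k)), (Rabs_pos_eq ((s ^ 2) ^ k)).
        + ring.
        + apply pow_le; lra.
        + left. now apply bc_pos.
      - apply is_series_scal_R. apply is_series_bc; [easy|]. rewrite Rabs_pos_eq; lra. }
    apply (is_series_ext_R (fun P => sum_f_R0 (fun k => a (P - 2 * k)%nat k) (P / 2))).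
    { intros P. unfold D. rewrite Rmult_comm, <- sum_f_R0_scal. apply sum_eq.
      intros k Hk. unfold a.
      assert (2 * k <= P)%nat by (assert (H1 := Nat.div_mod_eq P 2); lia).
      replace (P - 2 * k + 2 * k)%nat with P by lia. ring. }
    apply (is_series_diagonals a _ _ _ Ha HBa).
    - set (C := exp (- nu * ln (1 - s ^ 2))).
      (* The ratio comes from [2 * K * Rabs s <= 1 / 2] and [/ (1 - s^2) <= 16 / 15]. *)
      apply (ex_series_le_R _ (fun p => C * (3 / 4) ^ p)).
      + intros p. assert (HC : 0 < C) by apply exp_pos.
        rewrite Rabs_mult, Rabs_Rabsolu, (Rabs_pos_eq (exp _)) by (left; apply exp_pos).
        replace (- (nu + INR p) * ln (1 - s ^ 2)) with
          (- nu * ln (1 - s ^ 2) + INR p * - ln (1 - s ^ 2)) by ring.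
        rewrite exp_plus. fold C.
        replace (exp (INR p * - ln (1 - s ^ 2))) with ((/ (1 - s ^ 2)) ^ p).
        2:{ rewrite <- Rpower_pow by (apply Rinv_0_lt_compat; lra). unfold Rpower.
            now rewrite ln_Rinv by lra. }
        rewrite Rmult_comm, (Rmult_assoc C). apply Rmult_le_compat_l; [lra|].
        rewrite !Rabs_mult, <- !RPow_abs, (Rabs_pos_eq 2) by lra.
        apply Rle_trans with ((/ (1 - s ^ 2)) ^ p * (2 ^ p * K ^ p * Rabs s ^ p)).
        * apply Rmult_le_compat_l; [apply pow_le; left; apply Rinv_0_lt_compat; lra|].
          apply Rmult_le_compat_r; [apply pow_le, Rabs_pos|].
          apply Rmult_le_compat_l; [apply pow_le; lra|apply HKb].
        * rewrite <- !Rpow_mult_distr. apply pow_incr.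
          assert (Hks : K * Rabs s <= / 4).
          { apply Rle_trans with (K * / (4 * K)); [apply Rmult_le_compat_l; lra|].
            right. field. lra. }
          assert (Hi : / (1 - s ^ 2) <= 16 / 15).
          { replace (16 / 15) with (/ (15 / 16)) by field. apply Rinv_le_contravar; lra. }
          assert (0 < / (1 - s ^ 2)) by (apply Rinv_0_lt_compat; lra).
          assert (0 <= K * Rabs s) by (apply Rmult_le_pos; [lra|apply Rabs_pos]).
          split; [apply Rmult_le_pos; lra|]. nra.
      + destruct (ex_series_geom (3 / 4)) as [g Hg]; [rewrite Rabs_pos_eq; lra|].
        exists (C * g). now apply is_series_scal_R.
    - set (r := 2 * s / (1 + s ^ 2)).
      assert (Hr : Rabs r < / K).
      { unfold r, Rdiv. rewrite !Rabs_mult, (Rabs_pos_eq 2), (Rabs_pos_eq (/ (1 + s ^ 2)))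
          by (try (left; apply Rinv_0_lt_compat); lra).
        assert (/ (1 + s ^ 2) <= / 1) by (apply Rinv_le_contravar; lra).
        assert (0 < / (1 + s ^ 2)) by (apply Rinv_0_lt_compat; lra).
        assert (/ (4 * K) = / K / 4) by (field; lra). assert (0 < / K) by (apply Rinv_0_lt_compat; lra).
        assert (Hsp := Rabs_pos s). nra. }
      assert (Hr1 : Rabs r < 1).
      { apply Rlt_le_trans with (1 := Hr). rewrite <- Rinv_1. apply Rinv_le_contravar; lra. }
      replace (exp (- lam * ln (1 - 2 * xi * s ^ n + (s ^ n) ^ 2))) with
        (exp (- nu * ln (1 + s ^ 2)) * exp (- lam * ln (prodn (fun k => 1 - c k * r) n))).
      + apply (is_series_ext_R (fun p => exp (- nu * ln (1 + s ^ 2)) * (h p * r ^ p))).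
        * intros p. replace (- (nu + INR p) * ln (1 + s ^ 2)) with
            (- nu * ln (1 + s ^ 2) + INR p * - ln (1 + s ^ 2)) by ring.
          rewrite exp_plus.
          replace (exp (INR p * - ln (1 + s ^ 2))) with ((/ (1 + s ^ 2)) ^ p).
          -- unfold r, Rdiv. rewrite !Rpow_mult_distr. ring.
          -- rewrite <- Rpower_pow by (apply Rinv_0_lt_compat; lra). unfold Rpower.
             now rewrite ln_Rinv by lra.
        * apply is_series_scal_R. now apply HKs.
      + rewrite <- exp_plus. f_equal. rewrite <- Hprod.
        rewrite (prodn_ext (fun k => 1 - 2 * c k * s + s ^ 2) (fun k => (1 + s ^ 2) * (1 - c k * r))).
        2:{ intros k. unfold r. field. lra. }
        rewrite prodn_scal, ln_mult, ln_pow.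
        * unfold nu. ring.
        * lra.
        * apply pow_lt; lra.
        * apply prodn_pos. intros; now apply one_minus_mult_pos. }
  assert (Hrad : forall a : nat -> R, (forall s, Rabs s < delta ->
    is_series (fun N => a N * s ^ N) (exp (- lam * ln (1 - 2 * xi * s ^ n + (s ^ n) ^ 2)))) ->
    Rbar_lt 0 (CV_radius a)).
  { intros a Ha. apply Rbar_lt_le_trans with (Rabs (delta / 2)).
    - apply Rabs_pos_lt. lra.
    - apply ex_pseries_CV_radius. apply ex_pseries_R. eexists. apply Ha.
      rewrite Rabs_pos_eq; lra. }
  apply (PSeries_ext_recip (gap n (fun j => Gegenbauer lam j xi)) D N); [now apply Hrad..|].
  exists (mkposreal _ Hd). intros s Hs.
  assert (Hs' : Rabs s < delta).
  { unfold ball in Hs; simpl in Hs; unfold AbsRing_ball, abs, minus, plus, opp in Hs; simpl in Hs.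
    now rewrite Ropp_0, Rplus_0_r in Hs. }
  unfold PSeries. rewrite (is_series_unique _ _ (HL s Hs')), (is_series_unique _ _ (HR s Hs')).
  reflexivity.
Qed.

(** * Roots of unity *)

(* [f] is a polynomial function of degree at most [n] whose coefficient of degree [n] is [a]. *)
Fixpoint is_cpoly (n : nat) (a : C) (f : C -> C) : Prop :=
  match n with
  | O => forall z, f z = a
  | S n' => exists (c : C) (g : C -> C), is_cpoly n' a g /\ forall z, f z = (z * g z + c)%C
  end.

Lemma is_cpoly_add_scal n a b r f g : is_cpoly (S n) a f -> is_cpoly n b g ->
  is_cpoly (S n) a (fun z => f z + r * g z)%C.
Proof.
  revert f g. induction n as [|n IH]; intros f g (c & f0 & Hf0 & Hf) Hg.
  - simpl in Hf0, Hg. exists (c + r * b)%C, f0. split; [exact Hf0|].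
    intros z. rewrite Hf, Hg. ring.
  - destruct Hg as (c' & g0 & Hg0 & Hg).
    exists (c + r * c')%C, (fun z => f0 z + r * g0 z)%C. split; [now apply IH|].
    intros z. rewrite Hf, Hg. ring.
Qed.

(** From [f z = z * g z + c] follows [f z - f r = (z - r) * g z + r * (g z - g r)], and the
    induction hypothesis divides the last difference by [z - r]. *)
Lemma is_cpoly_divide n a f r : is_cpoly (S n) a f ->
  exists g, is_cpoly n a g /\ forall z, (f z - f r = (z - r) * g z)%C.
Proof.
  revert f. induction n as [|n IH]; intros f (c & g & Hg & Hf).
  - exists g. split; [exact Hg|]. intros z. simpl in Hg. rewrite !Hf, !Hg. ring.
  - destruct (IH g Hg) as (g' & Hg' & Hd).
    exists (fun z => g z + r * g' z)%C. split; [now apply is_cpoly_add_scal with a|].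
    intros z. rewrite !Hf. specialize (Hd z).
    replace (g r) with (g z - (z - r) * g' z)%C by (rewrite <- Hd; ring). ring.
Qed.

Fixpoint cprod (r : nat -> C) (z : C) (n : nat) : C :=
  match n with O => 1%C | S n' => (cprod r z n' * (z - r n'))%C end.

Lemma is_cpoly_factor n a f r : is_cpoly n a f ->
  (forall k, (k < n)%nat -> f (r k) = 0%C) ->
  (forall j k, (j < k < n)%nat -> r j <> r k) ->
  forall z, f z = (a * cprod r z n)%C.
Proof.
  revert f. induction n as [|n IH]; intros f Hf Hr Hd z.
  - simpl in *. rewrite Hf. ring.
  - destruct (is_cpoly_divide n a f (r n) Hf) as (g & Hg & Hfg).
    assert (Hfz : forall z, f z = ((z - r n) * g z)%C).
    { intros y. rewrite <- Hfg, (Hr n) by lia. ring. }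
    rewrite Hfz, (IH g Hg).
    + simpl. ring.
    + intros k Hk. assert (H := Hfz (r k)). rewrite Hr in H by lia.
      destruct (Ceq_dec (g (r k)) 0%C) as [H0|H0]; [easy|].
      exfalso. symmetry in H. revert H. apply Cmult_neq_0; [|easy].
      intros H. apply (Hd k n); [lia|].
      replace (r k) with (r k - r n + r n)%C by ring. rewrite H. ring.
    + intros j k Hjk. apply Hd. lia.
Qed.

Lemma is_cpoly_pow n : is_cpoly n 1%C (fun z => z ^ n)%C.
Proof.
  induction n as [|n IH]; [easy|]. exists 0%C, (fun z => z ^ n)%C. split; [easy|].
  intros z. rewrite Cpow_S. ring.
Qed.

Lemma is_cpoly_pow_minus n w : (0 < n)%nat -> is_cpoly n 1%C (fun z => z ^ n - w)%C.
Proof.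
  destruct n as [|n]; [lia|]. intros _. exists (- w)%C, (fun z => z ^ n)%C.
  split; [apply is_cpoly_pow|]. intros z. rewrite Cpow_S. ring.
Qed.

Definition cis (t : R) : C := (cos t, sin t).

Lemma cis_pow t n : (cis t ^ n)%C = cis (INR n * t).
Proof.
  induction n as [|n IH].
  - simpl. unfold cis. rewrite Rmult_0_l, cos_0, sin_0. easy.
  - rewrite Cpow_S, IH, S_INR. unfold cis, Cmult; simpl.
    replace ((INR n + 1) * t) with (t + INR n * t) by ring.
    rewrite cos_plus, sin_plus. f_equal. ring.
Qed.

Lemma cos_lt_1_open t : 0 < t < 2 * PI -> cos t < 1.
Proof.
  intros Ht. replace t with (2 * (t / 2)) by field. rewrite cos_2a_sin.
  assert (0 < sin (t / 2)) by (apply sin_gt_0; lra). nra.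
Qed.

Lemma cis_neq s t : 0 < t - s < 2 * PI -> cis s <> cis t.
Proof.
  intros H E. unfold cis in E. injection E as Ec Es.
  assert (Hc := cos_lt_1_open _ H). rewrite cos_minus, Ec, Es in Hc.
  generalize (sin2_cos2 t). unfold Rsqr. lra.
Qed.

Definition root_angle (n : nat) (th : R) (k : nat) : R := (th + 2 * PI * INR k) / INR n.

(** The points [cis (root_angle n th k)] are the [n] distinct roots of [z^n - cis th]. The identity
    is the squared modulus of the resulting factorization at the real point [s]: [N2] is
    multiplicative, and [N2 (s - cis t) = 1 - 2 cos t s + s^2]. *)
Lemma prodn_root_angle n th s : (0 < n)%nat ->
  prodn (fun k => 1 - 2 * cos (root_angle n th k) * s + s ^ 2) n =
  1 - 2 * cos th * s ^ n + (s ^ n) ^ 2.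
Proof.
  intros Hn. assert (Hn0 : 0 < INR n) by (apply lt_0_INR; lia).
  assert (HF := is_cpoly_factor n 1%C (fun z => z ^ n - cis th)%C
     (fun k => cis (root_angle n th k)) (is_cpoly_pow_minus n (cis th) Hn)).
  set (N2 := fun z : C => fst z ^ 2 + snd z ^ 2).
  assert (HN2 : forall x y, N2 (x * y)%C = N2 x * N2 y).
  { intros [x1 x2] [y1 y2]. unfold N2; simpl. ring. }
  assert (Hcis : forall (x t : R), N2 (RtoC x - cis t)%C = 1 - 2 * cos t * x + x ^ 2).
  { intros x t. unfold N2, cis; simpl. generalize (sin2_cos2 t). unfold Rsqr. lra. }
  rewrite <- Hcis, RtoC_pow, HF.
  - rewrite HN2. replace (N2 1%C) with 1 by (unfold N2; simpl; ring). rewrite Rmult_1_l.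
    assert (Hi : forall i, prodn (fun k => 1 - 2 * cos (root_angle n th k) * s + s ^ 2) i =
      N2 (cprod (fun k => cis (root_angle n th k)) (RtoC s) i)); [|apply Hi].
    intros i. induction i as [|i IH]; simpl prodn; simpl cprod.
    + unfold N2; simpl; ring.
    + now rewrite HN2, <- IH, Hcis.
  - intros k Hk. rewrite cis_pow. unfold root_angle.
    replace (INR n * ((th + 2 * PI * INR k) / INR n)) with (th + 2 * INR k * PI) by (field; lra).
    unfold cis. rewrite cos_period, sin_period. ring.
  - intros j k Hjk. apply cis_neq. unfold root_angle.
    replace ((th + 2 * PI * INR k) / INR n - (th + 2 * PI * INR j) / INR n)
      with (2 * PI * ((INR k - INR j) / INR n)) by (field; lra).
    assert (H1 : INR j < INR k) by (apply lt_INR; lia).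
    assert (H2 : INR k < INR n) by (apply lt_INR; lia).
    assert (H3 := pos_INR j). assert (HPI := PI_RGT_0).
    assert (0 < (INR k - INR j) / INR n) by (apply Rdiv_lt_0_compat; lra).
    assert ((INR k - INR j) / INR n < 1).
    { apply Rmult_lt_reg_r with (INR n); [easy|]. unfold Rdiv. rewrite Rmult_assoc, Rinv_l; lra. }
    nra.
Qed.

(** * An inverse pair of triangular sums *)

(* The summands telescope: the sum of the first [L + 1] of them is [T (S L)], with
   [T L = (-1)^(L-1) (mu)_L / ((L-1)! (K-L)! K (mu)_(K+L))]. *)
Lemma inverse_pair_orthogonality mu K : 0 < mu -> (0 < K)%nat ->
  sum_f_R0 (fun l => (mu + 2 * INR l) * ((-1) ^ l * bc mu l) /
     (INR (fact (K - l)) * poch mu (S (K + l)))) K = 0.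
Proof.
  intros Hmu HK.
  set (t := fun l => (mu + 2 * INR l) * ((-1) ^ l * bc mu l) /
     (INR (fact (K - l)) * poch mu (S (K + l)))).
  assert (H : forall L, (L < K)%nat -> sum_f_R0 t L =
     (-1) ^ L * poch mu (S L) /
     (INR (fact L) * INR (fact (K - S L)) * INR K * poch mu (K + S L))).
  { intros L. induction L as [|L IH]; intros HL.
    - simpl. unfold t, bc. simpl. rewrite Nat.sub_0_r, Nat.add_0_r.
      rewrite Nat.add_1_r. simpl.
      replace (INR (fact K)) with (INR K * INR (fact (K - 1))).
      2:{ destruct K as [|K']; [lia|]. rewrite fact_simpl, mult_INR.
          replace (S K' - 1)%nat with K' by lia. easy. }
      assert (H1 := poch_pos mu K Hmu). assert (H2 := INR_fact_lt_0 (K - 1)).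
      assert (H3 : 0 < INR K) by (apply lt_0_INR; lia).
      field. repeat split; lra.
    - rewrite tech5, IH by lia. unfold t, bc.
      replace (INR (fact (K - S L))) with (INR (K - S L) * INR (fact (K - S (S L)))).
      2:{ replace (K - S L)%nat with (S (K - S (S L))) by lia.
          now rewrite fact_simpl, mult_INR. }
      rewrite (fact_simpl L), mult_INR.
      replace (K + S (S L))%nat with (S (K + S L)) by lia.
      rewrite minus_INR by lia.
      rewrite !poch_S, plus_INR, !S_INR. simpl pow.
      assert (H1 := poch_pos mu (K + S L) Hmu). assert (H2 := INR_fact_lt_0 (K - S (S L))).
      assert (H4 := INR_fact_lt_0 L). assert (H5 := pos_INR L). assert (H6 := poch_pos mu L Hmu).
      assert (H3 : INR L + 1 < INR K) by (rewrite <- S_INR; apply lt_INR; lia).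
      field. repeat split; lra. }
  (* The closed form contains [fact (K - S L)] and stops at [L = K - 1]; the last summand, treated
     apart, cancels it. *)
  destruct K as [|K']; [lia|].
  rewrite tech5, H by lia. unfold t, bc. rewrite Nat.sub_diag.
  rewrite (fact_simpl K'), mult_INR. simpl (fact 0). rewrite !poch_S. simpl pow.
  rewrite plus_INR, !S_INR. simpl (INR 0).
  assert (H1 := poch_pos mu (S K' + S K') Hmu). assert (H4 := INR_fact_lt_0 K').
  assert (H5 := pos_INR K'). assert (H6 := poch_pos mu K' Hmu).
  field. repeat split; lra.
Qed.

(** Inserting the expression of [D] and collecting the terms with the same [K = k + l] leaves
    [e (p - 2 K)] times the sum of [inverse_pair_orthogonality] at [mu = nu + p - 2 K]. Only [K = 0]
    survives. *)
Lemma inverse_pair nu (e D : nat -> R) : 0 < nu ->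
  (forall N, D N = sum_f_R0 (fun l => e (N - 2 * l)%nat *
     ((-1) ^ l * bc (nu + INR (N - 2 * l)) l)) (N / 2)) ->
  forall p, e p / poch nu p =
  sum_f_R0 (fun k => (nu + INR (p - 2 * k)) / nu * D (p - 2 * k)%nat /
     (INR (fact k) * poch (nu + 1) (p - k))) (p / 2).
Proof.
  intros Hnu HD p. set (P := (p / 2)%nat).
  assert (HP : (2 * P <= p)%nat) by (assert (H1 := Nat.div_mod_eq p 2); unfold P; lia).
  set (X := fun k l => (nu + INR (p - 2 * k)) / nu / (INR (fact k) * poch (nu + 1) (p - k)) *
     (e (p - 2 * (k + l))%nat * ((-1) ^ l * bc (nu + INR (p - 2 * (k + l))) l))).
  transitivity (sum_f_R0 (fun k => sum_f_R0 (X k) (P - k)) P).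
  2:{ apply sum_eq. intros k Hk. unfold X. rewrite sum_f_R0_scal, HD.
      replace ((p - 2 * k) / 2)%nat with (P - k)%nat.
      2:{ unfold P. replace (p - 2 * k)%nat with (p - k * 2)%nat by lia.
          assert (H1 := Nat.div_mod_eq p 2). assert (H2 := Nat.div_mod_eq (p - k * 2) 2).
          assert (H3 := Nat.mod_upper_bound p 2). assert (H4 := Nat.mod_upper_bound (p - k * 2) 2).
          lia. }
      rewrite (sum_eq (fun l => e (p - 2 * (k + l))%nat * _)
        (fun l => e (p - 2 * k - 2 * l)%nat * ((-1) ^ l * bc (nu + INR (p - 2 * k - 2 * l)) l))).
      - unfold Rdiv. ring.
      - intros l Hl. replace (p - 2 * (k + l))%nat with (p - 2 * k - 2 * l)%nat by lia. easy. }
  rewrite sum_f_R0_triangle.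
  assert (Hin : forall K, (K <= P)%nat -> sum_f_R0 (fun l => X (K - l)%nat l) K =
    e (p - 2 * K)%nat / poch nu (p - 2 * K) *
    sum_f_R0 (fun l => ((nu + INR (p - 2 * K)) + 2 * INR l) * ((-1) ^ l * bc (nu + INR (p - 2 * K)) l) /
     (INR (fact (K - l)) * poch (nu + INR (p - 2 * K)) (S (K + l)))) K).
  { intros K HK. rewrite <- sum_f_R0_scal. apply sum_eq. intros l Hl. unfold X.
    replace (K - l + l)%nat with K by lia.
    replace (p - 2 * (K - l))%nat with (p - 2 * K + 2 * l)%nat by lia.
    replace (p - (K - l))%nat with (p - 2 * K + (K + l))%nat by lia.
    set (q := (p - 2 * K)%nat).
    (* Both sides are the Pochhammer symbol of [nu] with [q + K + l + 1] factors, split after the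
       first factor and after the first [q]. *)
    assert (Hp : nu * poch (nu + 1) (q + (K + l)) = poch nu q * poch (nu + INR q) (S (K + l))).
    { rewrite <- poch_add, Nat.add_succ_r. rewrite <- (Nat.add_1_l (q + (K + l))), (poch_add nu 1).
      simpl. ring. }
    replace (poch (nu + 1) (q + (K + l))) with (poch nu q * poch (nu + INR q) (S (K + l)) / nu)
      by (rewrite <- Hp; field; lra).
    rewrite plus_INR, mult_INR. simpl (INR 2).
    assert (0 < poch nu q) by (now apply poch_pos).
    assert (0 < poch (nu + INR q) (S (K + l))) by (apply poch_pos; generalize (pos_INR q); lra).
    assert (H6 := INR_fact_lt_0 (K - l)).
    field. repeat split; lra. }
  rewrite (sum_eq _ (fun K => match K with O => e p / poch nu p | S _ => 0 end)).
  - clear. induction P as [|P IH]; [easy|]. rewrite tech5, <- IH. ring.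
  - intros K HK. rewrite Hin by easy. destruct K as [|K].
    + rewrite Nat.mul_0_r, Nat.sub_0_r. unfold bc. simpl.
      assert (0 < poch nu p) by (now apply poch_pos).
      assert (H7 := pos_INR p). field. lra.
    + rewrite inverse_pair_orthogonality; [ring| |lia].
      generalize (pos_INR (p - 2 * S K)). lra.
Qed.

(** * Positive moment sequences *)

(* A list of pairs (coefficient, exponent) stands for a polynomial; [pmom M] is the linear
   functional sending [u^p] to [M p], so [pmom (pow u)] is evaluation at [u]. *)
Fixpoint pmom (M : nat -> R) (l : list (R * nat)) : R :=
  match l with nil => 0 | t :: l' => fst t * M (snd t) + pmom M l' end.

Definition positive_moments (M : nat -> R) : Prop :=
  M 0%nat = 1 /\
  forall l, (forall u, -1 <= u <= 1 -> 0 <= pmom (pow u) l) -> 0 <= pmom M l.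

Lemma pmom_app M l1 l2 : pmom M (l1 ++ l2) = pmom M l1 + pmom M l2.
Proof. induction l1 as [|t l1 IH]; simpl; [ring|]. rewrite IH. ring. Qed.

Lemma pmom_opp M l : pmom M (map (fun t => (- fst t, snd t)) l) = - pmom M l.
Proof. induction l as [|t l IH]; simpl; [ring|]. rewrite IH. ring. Qed.

Definition plist (g : nat -> R) (p : nat) : list (R * nat) :=
  map (fun i => (g i, i)) (seq 0 (S p)).

Lemma pmom_plist M g p : pmom M (plist g p) = sum_f_R0 (fun i => g i * M i) p.
Proof.
  unfold plist. induction p as [|p IH]; [simpl; ring|].
  rewrite seq_S, map_app, pmom_app, IH. simpl. ring.
Qed.

(** Positivity is applied to the polynomial [B - l]. *)
Lemma positive_moments_le M l B : positive_moments M ->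
  (forall u, -1 <= u <= 1 -> pmom (pow u) l <= B) -> pmom M l <= B.
Proof.
  intros [HM0 HM] H.
  assert (H0 : 0 <= pmom M ((B, 0%nat) :: map (fun t => (- fst t, snd t)) l)).
  { apply HM. intros u Hu. simpl. rewrite pmom_opp. specialize (H u Hu). lra. }
  simpl in H0. rewrite pmom_opp, HM0 in H0. lra.
Qed.

Lemma positive_moments_bounded M p : positive_moments M -> Rabs (M p) <= 1.
Proof.
  intros HM.
  assert (Hp : forall u, -1 <= u <= 1 -> Rabs (u ^ p) <= 1).
  { intros u Hu. rewrite <- RPow_abs, <- (pow1 p). apply pow_incr.
    split; [apply Rabs_pos|]. now apply Rabs_le. }
  assert (H1 : pmom M ((1, p) :: nil) <= 1).
  { apply positive_moments_le; [easy|]. intros u Hu. specialize (Hp u Hu). simpl.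
    generalize (Rle_abs (u ^ p)). lra. }
  assert (H2 : pmom M ((-1, p) :: nil) <= 1).
  { apply positive_moments_le; [easy|]. intros u Hu. specialize (Hp u Hu). simpl.
    generalize (Rle_abs (- u ^ p)). rewrite Rabs_Ropp. lra. }
  simpl in H1, H2. apply Rabs_le. lra.
Qed.

Lemma positive_moments_point c : -1 <= c <= 1 -> positive_moments (pow c).
Proof. intros Hc. split; [easy|]. intros l Hl. now apply Hl. Qed.

(** The moments of [tau * u + sigma] when [u] has the moments [M]. *)
Definition push (M : nat -> R) (tau sigma : R) (p : nat) : R :=
  sum_f_R0 (fun i => Binomial.C p i * tau ^ i * sigma ^ (p - i) * M i) p.

Lemma positive_moments_push M tau sigma : positive_moments M ->
  (forall u, -1 <= u <= 1 -> -1 <= tau * u + sigma <= 1) ->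
  positive_moments (push M tau sigma).
Proof.
  intros [HM0 HM] Hts. split.
  - unfold push; simpl. rewrite HM0, C_n_0. ring.
  - intros l Hl.
    (* [sub l] is the polynomial [l] composed with the affine map. Evaluating the pushed moments on
       [l] is evaluating [M] on [sub l], which is non-negative on [[-1, 1]] because the map
       preserves that interval. *)
    set (sub := fun l : list (R * nat) => flat_map (fun t =>
       plist (fun i => fst t * (Binomial.C (snd t) i * tau ^ i * sigma ^ (snd t - i))) (snd t)) l).
    assert (Hsub : forall M l, pmom M (sub l) = pmom (push M tau sigma) l).
    { intros M0 l0. induction l0 as [|[a p] l0 IH]; [easy|].
      change (sub ((a, p) :: l0)) with
        (plist (fun i => a * (Binomial.C p i * tau ^ i * sigma ^ (p - i))) p ++ sub l0).
      rewrite pmom_app, IH, pmom_plist. simpl pmom. f_equal.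
      unfold push. rewrite <- sum_f_R0_scal. apply sum_eq. intros; ring. }
    rewrite <- Hsub. apply HM. intros u Hu. rewrite Hsub.
    replace (pmom (push (pow u) tau sigma) l) with (pmom (pow (tau * u + sigma)) l).
    + apply Hl. now apply Hts.
    + clear Hl. induction l as [|[a p] l IH]; [easy|]. simpl. rewrite IH. f_equal. f_equal.
      unfold push. rewrite binomial. apply sum_eq. intros i Hi.
      rewrite Rpow_mult_distr. ring.
Qed.

(** [pmom] is linear in the moments, so the functional of the mixture is the integral of a
    non-negative function. *)
Lemma positive_moments_mixture (Mf : R -> nat -> R) (wt : R -> R) A B M : A <= B ->
  (forall phi, A < phi < B -> positive_moments (Mf phi)) ->
  (forall phi, A < phi < B -> 0 <= wt phi) ->
  (forall p, is_RInt (fun phi => wt phi * Mf phi p) A B (M p)) ->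
  M 0%nat = 1 -> positive_moments M.
Proof.
  intros HAB HMf Hwt HI HM0. split; [easy|]. intros l Hl.
  assert (Hint : is_RInt (fun phi => wt phi * pmom (Mf phi) l) A B (pmom M l)).
  { clear Hl. induction l as [|[a p] l IH]; simpl.
    - apply (is_RInt_ext (fun _ => 0)); [intros; simpl; ring|].
      assert (H := is_RInt_const (V := R_NormedModule) A B 0).
      unfold scal in H; simpl in H; unfold mult in H; simpl in H. now rewrite Rmult_0_r in H.
    - apply (is_RInt_ext (fun phi => plus (scal a (wt phi * Mf phi p)) (wt phi * pmom (Mf phi) l))).
      + intros phi _. unfold plus, scal; simpl. unfold mult; simpl. ring.
      + apply (is_RInt_plus (V := R_NormedModule)); [|exact IH].
        apply (is_RInt_scal (V := R_NormedModule)), HI. }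
  rewrite <- (is_RInt_unique _ _ _ _ Hint). apply RInt_ge_0; [easy|eexists; exact Hint|].
  intros phi Hphi. apply Rmult_le_pos; [now apply Hwt|]. now apply (HMf phi Hphi).
Qed.

(** * Wallis integrals and Beta laws *)

Definition wallis (a b : nat) : R := RInt (fun t => sin t ^ a * cos t ^ b) 0 (PI / 2).

Lemma continuous_sin_cos_pow a b t : continuous (fun t => sin t ^ a * cos t ^ b) t.
Proof.
  apply (ex_derive_continuous (K := R_AbsRing) (V := R_NormedModule)). auto_derive. easy.
Qed.

Lemma is_RInt_wallis a b : is_RInt (fun t => sin t ^ a * cos t ^ b) 0 (PI / 2) (wallis a b).
Proof.
  apply (RInt_correct (V := R_CompleteNormedModule)), (ex_RInt_continuous (V := R_CompleteNormedModule)).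
  intros; apply continuous_sin_cos_pow.
Qed.

Lemma wallis_pos a b : 0 < wallis a b.
Proof.
  assert (HPI := PI_RGT_0). apply RInt_gt_0; [lra| |intros; apply continuous_sin_cos_pow].
  intros t Ht. apply Rmult_lt_0_compat; apply pow_lt; [apply sin_gt_0|apply cos_gt_0]; lra.
Qed.

Lemma wallis_split a b : wallis a b = wallis (a + 2) b + wallis a (b + 2).
Proof.
  apply is_RInt_unique.
  apply (is_RInt_ext (fun t => plus (sin t ^ (a + 2) * cos t ^ b) (sin t ^ a * cos t ^ (b + 2)))).
  - intros t _. unfold plus; simpl. rewrite !pow_add. generalize (sin2_cos2 t). unfold Rsqr.
    intros H. replace (sin t ^ 2) with (1 - cos t ^ 2) by (simpl; lra). ring.
  - apply (is_RInt_plus (V := R_NormedModule)); apply is_RInt_wallis.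
Qed.

(** Integrating the derivative of [sin^(a + 1) cos^(b + 1)], which vanishes at both ends of the
    interval. *)
Lemma wallis_parts a b : (INR a + 1) * wallis a (b + 2) = (INR b + 1) * wallis (a + 2) b.
Proof.
  assert (H0 : is_RInt (fun t => (INR a + 1) * (sin t ^ a * cos t ^ (b + 2))
      - (INR b + 1) * (sin t ^ (a + 2) * cos t ^ b)) 0 (PI / 2)
      (minus (sin (PI / 2) ^ S a * cos (PI / 2) ^ S b) (sin 0 ^ S a * cos 0 ^ S b))).
  { apply (is_RInt_derive (V := R_CompleteNormedModule) (fun t => sin t ^ S a * cos t ^ S b)).
    - intros t _. auto_derive; [easy|]. rewrite !pow_add.
      change (match a with O => 1 | S _ => INR a + 1 end) with (INR (S a)).
      change (match b with O => 1 | S _ => INR b + 1 end) with (INR (S b)).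
      rewrite !S_INR. simpl. ring.
    - intros t _. apply (ex_derive_continuous (K := R_AbsRing) (V := R_NormedModule)).
      auto_derive. easy. }
  assert (H1 : is_RInt (fun t => (INR a + 1) * (sin t ^ a * cos t ^ (b + 2))
      - (INR b + 1) * (sin t ^ (a + 2) * cos t ^ b)) 0 (PI / 2)
      (minus (scal (INR a + 1) (wallis a (b + 2))) (scal (INR b + 1) (wallis (a + 2) b)))).
  { apply (is_RInt_minus (V := R_NormedModule)); apply (is_RInt_scal (V := R_NormedModule));
      apply is_RInt_wallis. }
  apply (is_RInt_unique (V := R_CompleteNormedModule)) in H0.
  apply (is_RInt_unique (V := R_CompleteNormedModule)) in H1. rewrite H1 in H0.
  rewrite cos_PI2, sin_0 in H0.
  unfold minus, plus, opp, scal in H0; simpl in H0; unfold mult in H0; simpl in H0. lra.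
Qed.

(** [wallis a b] is half the Beta function at [((a + 1) / 2, (b + 1) / 2)], and the quotient gives
    the mixed moments of the Beta law. [wallis_split] and [wallis_parts] are two linear equations
    determining the effect of raising one exponent by [2]; no Gamma value at a half-integer
    enters. *)
Lemma wallis_ratio a b q r :
  wallis (a + 2 * q) (b + 2 * r) =
  wallis a b * (poch ((INR a + 1) / 2) q * poch ((INR b + 1) / 2) r /
    poch ((INR a + INR b + 2) / 2) (q + r)).
Proof.
  assert (Ha := pos_INR a). assert (Hb := pos_INR b).
  assert (Hpos : forall k, 0 < poch ((INR a + INR b + 2) / 2) k) by (intros; apply poch_pos; lra).
  induction q as [|q IHq].
  - rewrite Nat.mul_0_r, Nat.add_0_r. simpl (0 + r)%nat. simpl (poch _ 0).
    induction r as [|r IHr].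
    + rewrite Nat.mul_0_r, Nat.add_0_r. simpl. field.
    + replace (b + 2 * S r)%nat with ((b + 2 * r) + 2)%nat by lia.
      assert (H1 := wallis_split a (b + 2 * r)). assert (H2 := wallis_parts a (b + 2 * r)).
      assert (Hr := pos_INR r). specialize (Hpos r). rewrite !poch_S.
      rewrite plus_INR, mult_INR in H2. simpl (INR 2) in H2.
      assert (H3 : wallis a (b + 2 * r + 2) =
        (INR b + 2 * INR r + 1) / (INR a + INR b + 2 * INR r + 2) * wallis a (b + 2 * r)).
      { rewrite H1. apply Rmult_eq_reg_l with (INR a + INR b + 2 * INR r + 2); [|lra].
        field_simplify; [|lra]. lra. }
      rewrite H3, IHr. field. lra.
  - replace (a + 2 * S q)%nat with ((a + 2 * q) + 2)%nat by lia.
    assert (H1 := wallis_split (a + 2 * q) (b + 2 * r)).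
    assert (H2 := wallis_parts (a + 2 * q) (b + 2 * r)).
    assert (Hr := pos_INR r). assert (Hq := pos_INR q). specialize (Hpos (q + r)%nat).
    change (S q + r)%nat with (S (q + r)). rewrite !poch_S, plus_INR.
    rewrite !plus_INR, !mult_INR in H2. simpl (INR 2) in H2.
    assert (H3 : wallis (a + 2 * q + 2) (b + 2 * r) =
      (INR a + 2 * INR q + 1) / (INR a + INR b + 2 * INR q + 2 * INR r + 2) *
      wallis (a + 2 * q) (b + 2 * r)).
    { rewrite H1. apply Rmult_eq_reg_l with (INR a + INR b + 2 * INR q + 2 * INR r + 2); [|lra].
      field_simplify; [|lra]. lra. }
    rewrite H3, IHq. field. lra.
Qed.

Lemma is_RInt_sum (f : nat -> R -> R) (v : nat -> R) A B n :
  (forall i, (i <= n)%nat -> is_RInt (f i) A B (v i)) ->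
  is_RInt (fun t => sum_f_R0 (fun i => f i t) n) A B (sum_f_R0 v n).
Proof.
  induction n as [|n IH]; intros H; simpl; [apply H; lia|].
  apply (is_RInt_plus (V := R_NormedModule) (fun t => sum_f_R0 (fun i => f i t) n) (f (S n)));
    [apply IH; intros; apply H; lia|apply H; lia].
Qed.

(* With [t = sin^2 phi], the weight below is the density of a Beta law, so this is the
   law of [(1 - t) u + t c] for independent [u] (with moments [M]) and [t]. *)
Lemma positive_moments_beta M c a b : positive_moments M -> -1 <= c <= 1 ->
  positive_moments (fun p => sum_f_R0 (fun i => Binomial.C p i * c ^ (p - i) * M i *
    (wallis (a + 2 * (p - i)) (b + 2 * i) / wallis a b)) p).
Proof.
  intros HM Hc. assert (HW := wallis_pos a b). assert (HPI := PI_RGT_0).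
  apply positive_moments_mixture with
    (Mf := fun phi => push M (cos phi ^ 2) (sin phi ^ 2 * c))
    (wt := fun phi => sin phi ^ a * cos phi ^ b / wallis a b) (A := 0) (B := PI / 2).
  - lra.
  - intros phi _. apply positive_moments_push; [easy|]. intros u Hu.
    generalize (sin2_cos2 phi). unfold Rsqr. intros Hsc.
    assert (0 <= sin phi ^ 2) by apply pow2_ge_0. assert (0 <= cos phi ^ 2) by apply pow2_ge_0.
    assert (sin phi ^ 2 + cos phi ^ 2 = 1) by (simpl; lra). nra.
  - intros phi Hphi. left. apply Rdiv_lt_0_compat; [|easy].
    apply Rmult_lt_0_compat; apply pow_lt; [apply sin_gt_0|apply cos_gt_0]; lra.
  - intros p. unfold push.
    apply (is_RInt_ext (fun phi => sum_f_R0 (fun i => (Binomial.C p i * c ^ (p - i) * M i / wallis a b) *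
      (sin phi ^ (a + 2 * (p - i)) * cos phi ^ (b + 2 * i))) p)).
    + intros phi _. rewrite <- sum_f_R0_scal. apply sum_eq. intros i Hi.
      rewrite !pow_add, !pow_mult, Rpow_mult_distr. field. lra.
    + apply is_RInt_sum. intros i Hi.
      replace (Binomial.C p i * c ^ (p - i) * M i * (wallis (a + 2 * (p - i)) (b + 2 * i) / wallis a b))
        with ((Binomial.C p i * c ^ (p - i) * M i / wallis a b) *
          (wallis (a + 2 * (p - i)) (b + 2 * i))) by (field; lra).
      exact (is_RInt_scal (V := R_NormedModule) _ _ _ _ _ (is_RInt_wallis _ _)).
  - simpl. rewrite !Nat.add_0_r, C_n_0, (proj1 HM). field. lra.
Qed.

(* Moments of [sum_k t_k c_k] when [t] follows the Dirichlet law with all parameters [lam]. *)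
Definition dirichlet_moment (lam : R) (c : nat -> R) (n p : nat) : R :=
  INR (fact p) * hconv lam c n p / poch (INR n * lam) p.

Lemma positive_moments_dirichlet d c n : (0 < d)%nat -> (forall k, -1 <= c k <= 1) ->
  positive_moments (dirichlet_moment (INR d / 2) c (S n)).
Proof.
  intros Hd Hc. set (lam := INR d / 2).
  assert (Hdp : 0 < INR d) by (apply lt_0_INR; lia).
  assert (Hl : 0 < lam) by (unfold lam; lra).
  assert (Hext : forall M M', (forall p, M p = M' p) -> positive_moments M -> positive_moments M').
  { intros M M' H [H0 HM]. assert (Hm : forall l, pmom M l = pmom M' l).
    { intros l. induction l as [|t l IH]; simpl; [easy|]. now rewrite IH, H. }
    split; [now rewrite <- H|]. intros l. rewrite <- Hm. apply HM. }
  induction n as [|n IH].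
  - apply Hext with (pow (c 0%nat)); [|apply positive_moments_point, Hc].
    intros p. unfold dirichlet_moment. simpl hconv.
    replace (PS_mult _ _ p) with (bc lam p * c 0%nat ^ p).
    + unfold bc. simpl (INR 1). rewrite Rmult_1_l.
      assert (H1 := poch_pos lam p Hl). assert (H2 := INR_fact_lt_0 p). field. lra.
    + unfold PS_mult. destruct p as [|p]; [simpl; ring|].
      rewrite decomp_sum by lia. rewrite Nat.sub_0_r, sum_f_R0_zero; [ring|].
      intros; simpl; ring.
  (* In a Dirichlet law with one more parameter [lam], the new coordinate [t] is Beta with
     parameters [lam] and [S n * lam], and the others are [1 - t] times an independent Dirichlet
     vector. With [t = sin^2 phi] and [d = 2 lam], that Beta law has the exponents [d - 1] and
     [S n * d - 1]. *)
  - assert (Hb := positive_moments_beta _ (c (S n)) (d - 1) (S n * d - 1) IH (Hc (S n))).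
    revert Hb. apply Hext. intros p.
    unfold dirichlet_moment.
    change (hconv lam c (S (S n))) with
      (PS_mult (hconv lam c (S n)) (fun q => bc lam q * c (S n) ^ q)).
    set (h := hconv lam c (S n)). unfold PS_mult.
    match goal with |- _ = ?A * ?B / ?D => replace (A * B / D) with (A / D * B)
      by (unfold Rdiv; ring) end.
    rewrite <- sum_f_R0_scal. apply sum_eq. intros i Hi.
    rewrite wallis_ratio, !minus_INR by nia. rewrite mult_INR.
    change (INR 1) with 1.
    replace ((INR d - 1 + 1) / 2) with lam by (unfold lam; field).
    replace ((INR (S n) * INR d - 1 + 1) / 2) with (INR (S n) * lam) by (unfold lam; field).
    replace ((INR d - 1 + (INR (S n) * INR d - 1) + 2) / 2) with (INR (S (S n)) * lam)
      by (rewrite (S_INR (S n)); unfold lam; field).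
    replace (p - i + i)%nat with p by lia.
    assert (Hn : forall j, 0 < INR (S j) * lam)
      by (intros; apply Rmult_lt_0_compat; [apply lt_0_INR; lia|easy]).
    assert (H1 := poch_pos _ i (Hn n)). assert (H2 := poch_pos _ p (Hn (S n))).
    assert (H3 := wallis_pos (d - 1) (S n * d - 1)).
    assert (H4 := INR_fact_lt_0 i). assert (H5 := INR_fact_lt_0 (p - i)).
    unfold Binomial.C, bc. field. repeat split; lra.
Qed.

Lemma positive_moments_average c n : (forall k, -1 <= c k <= 1) ->
  positive_moments (fun p => sum_f_R0 (fun k => c k ^ p) n / INR (S n)).
Proof.
  intros Hc. assert (Hn : 0 < INR (S n)) by (apply lt_0_INR; lia). split.
  - simpl pow. rewrite sum_cte. field. lra.
  - intros l Hl.
    replace (pmom _ l) with (sum_f_R0 (fun k => pmom (pow (c k)) l) n / INR (S n)).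
    + apply Rmult_le_pos; [|left; now apply Rinv_0_lt_compat].
      apply cond_pos_sum. intros k. apply Hl, Hc.
    + clear Hl. induction l as [|[a p] l IH]; cbn [pmom fst snd].
      * rewrite sum_cte. field. lra.
      * rewrite plus_sum, <- IH, sum_f_R0_scal. field. lra.
Qed.

(** * Taylor series and the bound on Fourier transforms *)

Lemma cos_INR_PI n : cos (INR n * PI) = (-1) ^ n.
Proof.
  induction n as [|n IH]; [simpl; now rewrite Rmult_0_l, cos_0|].
  rewrite S_INR, Rmult_plus_distr_r, Rmult_1_l, neg_cos, IH. simpl. ring.
Qed.

Lemma sin_INR_PI n : sin (INR n * PI) = 0.
Proof.
  induction n as [|n IH]; [simpl; now rewrite Rmult_0_l, sin_0|].
  rewrite S_INR, Rmult_plus_distr_r, Rmult_1_l, neg_sin, IH. ring.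
Qed.

Lemma even_half_PI n : INR (2 * n) * (PI / 2) = INR n * PI.
Proof. rewrite mult_INR. simpl (INR 2). field. Qed.

Lemma odd_half_PI n : INR (2 * n + 1) * (PI / 2) = PI / 2 + INR n * PI.
Proof. rewrite plus_INR, mult_INR. simpl (INR 2). simpl (INR 1). field. Qed.

(** [cos (p PI / 2)] and [sin (p PI / 2)] are the real and imaginary parts of [i^p]. Summing over
    all [p], instead of one parity, gives cosine and sine the shape in which the kernel appears. *)
Lemma is_series_cos x :
  is_series (fun p => x ^ p / INR (fact p) * cos (INR p * (PI / 2))) (cos x).
Proof.
  apply (is_series_ext_R (fun p => cos (INR p * (PI / 2)) / INR (fact p) * x ^ p)).
  { intros p. unfold Rdiv. ring. }
  apply is_pseries_R. replace (cos x) with (cos x + x * 0) by ring.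
  apply is_pseries_odd_even; apply is_pseries_R.
  - assert (H : infinite_sum (fun i => cos_n i * (x ^ 2) ^ i) (cos x)).
    { unfold cos. destruct (exist_cos (Rsqr x)) as [l Hl].
      unfold cos_in in Hl. now rewrite Rsqr_pow2 in Hl. }
    apply is_series_Reals in H. apply is_series_ext_R with (2 := H). intros i.
    rewrite even_half_PI, cos_INR_PI. reflexivity.
  - apply is_series_ext_R with (2 := is_series_zero). intros i.
    rewrite odd_half_PI, cos_plus, cos_PI2, sin_INR_PI. unfold Rdiv. ring.
Qed.

Lemma is_series_sin x :
  is_series (fun p => x ^ p / INR (fact p) * sin (INR p * (PI / 2))) (sin x).
Proof.
  apply (is_series_ext_R (fun p => sin (INR p * (PI / 2)) / INR (fact p) * x ^ p)).
  { intros p. unfold Rdiv. ring. }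
  assert (H : exists l, infinite_sum (fun i => sin_n i * (x ^ 2) ^ i) l /\ sin x = x * l).
  { unfold sin. destruct (exist_sin (Rsqr x)) as [l Hl]. exists l.
    unfold sin_in in Hl. now rewrite Rsqr_pow2 in Hl. }
  destruct H as (l & Hl & ->). apply is_pseries_R.
  replace (x * l) with (0 + x * l) by ring.
  apply is_pseries_odd_even; apply is_pseries_R.
  - apply is_series_ext_R with (2 := is_series_zero). intros i.
    rewrite even_half_PI, sin_INR_PI. unfold Rdiv. ring.
  - apply is_series_Reals in Hl. apply is_series_ext_R with (2 := Hl). intros i.
    rewrite odd_half_PI, sin_plus, sin_PI2, sin_INR_PI, cos_INR_PI. unfold sin_n, Rdiv. ring.
Qed.

Lemma is_series_exp x : is_series (fun p => x ^ p / INR (fact p)) (exp x).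
Proof.
  apply is_series_ext_R with (fun p => / INR (fact p) * x ^ p).
  - intros p. unfold Rdiv. ring.
  - apply is_pseries_R, is_exp_Reals.
Qed.

Lemma is_series_tail_le (a b : nat -> R) la lb N :
  (forall p, Rabs (a p) <= b p) -> is_series a la -> is_series b lb ->
  Rabs (la - sum_f_R0 a N) <= lb - sum_f_R0 b N.
Proof.
  intros Hab Ha Hb. apply is_series_is_lim_seq in Ha, Hb.
  change (Rbar_le (Rabs (la - sum_f_R0 a N)) (lb - sum_f_R0 b N)).
  apply (is_lim_seq_le_loc (fun m => Rabs (sum_f_R0 a m - sum_f_R0 a N))
    (fun m => sum_f_R0 b m - sum_f_R0 b N)).
  - exists N. intros m Hm. induction Hm as [|m Hm IH].
    + rewrite !Rminus_diag, Rabs_R0. lra.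
    + simpl. replace (sum_f_R0 a m + a (S m) - sum_f_R0 a N)
        with ((sum_f_R0 a m - sum_f_R0 a N) + a (S m)) by ring.
      generalize (Rabs_triang (sum_f_R0 a m - sum_f_R0 a N) (a (S m))) (Hab (S m)). lra.
  - apply (is_lim_seq_abs _ (la - sum_f_R0 a N)).
    apply is_lim_seq_minus'; [easy|apply is_lim_seq_const].
  - apply is_lim_seq_minus'; [easy|apply is_lim_seq_const].
Qed.

Lemma ex_series_moments (M g : nat -> R) w :
  (forall p, Rabs (M p) <= 1) -> (forall p, Rabs (g p) <= 1) ->
  ex_series (fun p => w ^ p / INR (fact p) * g p * M p).
Proof.
  intros HM Hg. apply (ex_series_le_R _ (fun p => Rabs w ^ p / INR (fact p))).
  - intros p. assert (Hf := INR_fact_lt_0 p). unfold Rdiv.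
    rewrite !Rabs_mult, <- RPow_abs, (Rabs_pos_eq (/ INR (fact p)))
      by (left; now apply Rinv_0_lt_compat).
    assert (0 <= Rabs w ^ p * / INR (fact p)).
    { apply Rmult_le_pos; [apply pow_le, Rabs_pos|left; now apply Rinv_0_lt_compat]. }
    rewrite Rmult_assoc. rewrite <- Rmult_1_r. apply Rmult_le_compat_l; [easy|].
    rewrite <- (Rmult_1_r 1). apply Rmult_le_compat; try apply Rabs_pos; easy.
  - eexists. apply is_series_exp.
Qed.

(** By linearity [X^2 + Y^2] is the functional applied to [X cos (w u) + Y sin (w u)]. By
    Cauchy-Schwarz that function is at most [rho = sqrt (X^2 + Y^2)] on [[-1, 1]], whence
    [rho^2 <= rho]. The functional being defined on polynomials, the argument is run on Taylor
    polynomials with an error that tends to [0]. *)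
Lemma positive_moments_fourier_bound M w X Y : positive_moments M ->
  is_series (fun p => w ^ p / INR (fact p) * cos (INR p * (PI / 2)) * M p) X ->
  is_series (fun p => w ^ p / INR (fact p) * sin (INR p * (PI / 2)) * M p) Y ->
  X ^ 2 + Y ^ 2 <= 1.
Proof.
  intros HM HX HY.
  set (rho := sqrt (X ^ 2 + Y ^ 2)).
  assert (Hsq : 0 <= X ^ 2 + Y ^ 2) by (generalize (pow2_ge_0 X) (pow2_ge_0 Y); lra).
  assert (Hrho : rho * rho = X ^ 2 + Y ^ 2) by (now apply sqrt_sqrt).
  assert (Hrho0 : 0 <= rho) by apply sqrt_pos.
  set (g := fun p => w ^ p / INR (fact p) *
    (X * cos (INR p * (PI / 2)) + Y * sin (INR p * (PI / 2)))).
  set (B := Rabs X + Rabs Y).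
  (* The tail of a majorant of the Taylor series of [X cos (w u) + Y sin (w u)], uniform for [u] in
     [[-1, 1]]. *)
  set (eps := fun N => B * exp (Rabs w) - sum_f_R0 (fun p => B * (Rabs w ^ p / INR (fact p))) N).
  assert (Hle : forall N, sum_f_R0 (fun p => g p * M p) N <= rho + eps N).
  { intros N. rewrite <- pmom_plist. apply positive_moments_le; [easy|]. intros u Hu.
    rewrite pmom_plist.
    assert (Hs : is_series (fun p => g p * u ^ p) (X * cos (w * u) + Y * sin (w * u))).
    { apply is_series_ext_R with (2 := is_series_plus _ _ _ _
        (is_series_scal_R X _ _ (is_series_cos (w * u)))
        (is_series_scal_R Y _ _ (is_series_sin (w * u)))).
      intros p. unfold plus; simpl. unfold g. rewrite Rpow_mult_distr. unfold Rdiv. ring. }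
    assert (Hb : is_series (fun p => B * (Rabs w ^ p / INR (fact p))) (B * exp (Rabs w))).
    { apply is_series_scal_R, is_series_exp. }
    assert (Ht : Rabs (X * cos (w * u) + Y * sin (w * u) - sum_f_R0 (fun p => g p * u ^ p) N) <= eps N).
    { apply is_series_tail_le; [|exact Hs|exact Hb]. intros p. unfold g.
      assert (Hf := INR_fact_lt_0 p). unfold Rdiv.
      rewrite !Rabs_mult, <- !RPow_abs, (Rabs_pos_eq (/ INR (fact p)))
        by (left; now apply Rinv_0_lt_compat).
      assert (H0 : 0 <= Rabs w ^ p * / INR (fact p)).
      { apply Rmult_le_pos; [apply pow_le, Rabs_pos|left; now apply Rinv_0_lt_compat]. }
      assert (H1 : Rabs u ^ p <= 1).
      { rewrite <- (pow1 p). apply pow_incr. split; [apply Rabs_pos|]. now apply Rabs_le. }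
      assert (H2 : Rabs (X * cos (INR p * (PI / 2)) + Y * sin (INR p * (PI / 2))) <= B).
      { eapply Rle_trans; [apply Rabs_triang|]. rewrite !Rabs_mult. unfold B.
        assert (Rabs (cos (INR p * (PI / 2))) <= 1) by (apply Rabs_le; apply COS_bound).
        assert (Rabs (sin (INR p * (PI / 2))) <= 1) by (apply Rabs_le; apply SIN_bound).
        generalize (Rabs_pos X) (Rabs_pos Y). intros. nra. }
      assert (H3 := Rabs_pos (X * cos (INR p * (PI / 2)) + Y * sin (INR p * (PI / 2)))).
      assert (H4 : 0 <= Rabs u ^ p) by (apply pow_le, Rabs_pos).
      set (e := Rabs w ^ p * / INR (fact p)) in *.
      rewrite (Rmult_comm B), Rmult_assoc. apply Rmult_le_compat_l; [easy|]. nra. }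
    assert (Hcs : X * cos (w * u) + Y * sin (w * u) <= rho).
    { assert (Hsc := sin2_cos2 (w * u)). unfold Rsqr in Hsc.
      apply Rsqr_incr_0_var; [|easy]. unfold Rsqr. rewrite Hrho.
      assert (0 <= (X * sin (w * u) - Y * cos (w * u)) ^ 2) by apply pow2_ge_0. nra. }
    apply Rabs_le_between in Ht. lra. }
  assert (Hlim : Rbar_le (X ^ 2 + Y ^ 2) rho).
  { apply (is_lim_seq_le (sum_f_R0 (fun p => g p * M p)) (fun N => rho + eps N)); [exact Hle| |].
    - apply is_series_is_lim_seq.
      replace (X ^ 2 + Y ^ 2) with (plus (X * X) (Y * Y)) by (unfold plus; simpl; ring).
      apply is_series_ext_R with (2 := is_series_plus _ _ _ _
        (is_series_scal_R X _ _ HX) (is_series_scal_R Y _ _ HY)).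
      intros p. unfold plus; simpl. unfold g. ring.
    - replace (Finite rho) with (Finite (rho + (B * exp (Rabs w) - B * exp (Rabs w)))) by (f_equal; ring).
      apply is_lim_seq_plus'; [apply is_lim_seq_const|].
      apply is_lim_seq_minus'; [apply is_lim_seq_const|].
      apply is_series_is_lim_seq, is_series_scal_R, is_series_exp. }
  simpl Rbar_le in Hlim. rewrite <- Hrho in *. nra.
Qed.

(** * The moments of the kernel *)

(** [inverse_pair] at [nu = n lam] inverts [Gegenbauer_hconv]. On the multiples [N = n j] its weight
    [(nu + N) / nu] is exactly the factor [(lam + j) / lam] of the kernel. *)
Lemma kernel_coefficient_identity lam n th p : 0 < lam -> (0 < n)%nat ->
  2 ^ p * dirichlet_moment lam (fun k => cos (root_angle n th k)) n p / INR (fact p) =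
  sum_f_R0 (fun k => gap n (fun j => (lam + INR j) / lam * Gegenbauer lam j (cos th)) (p - 2 * k) /
     (INR (fact k) * poch (INR n * lam + 1) (p - k))) (p / 2).
Proof.
  intros Hl Hn. set (c := fun k => cos (root_angle n th k)).
  assert (Hn0 : 0 < INR n) by (apply lt_0_INR; lia).
  assert (Hnu : 0 < INR n * lam) by (now apply Rmult_lt_0_compat).
  assert (HD := Gegenbauer_hconv lam c n (cos th) Hl Hn
    (fun k => Rabs_le _ _ (COS_bound _)) (Rabs_le _ _ (COS_bound th))
    (fun s => prodn_root_angle n th s Hn)).
  transitivity (2 ^ p * hconv lam c n p / poch (INR n * lam) p).
  { unfold dirichlet_moment. assert (H1 := INR_fact_lt_0 p). assert (H2 := poch_pos _ p Hnu).
    field. lra. }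
  rewrite (inverse_pair (INR n * lam) (fun p => 2 ^ p * hconv lam c n p) _ Hnu HD).
  apply sum_eq. intros k Hk. f_equal. unfold gap.
  destruct (Nat.eqb_spec ((p - 2 * k) mod n) 0) as [H|H]; [|apply Rmult_0_r].
  f_equal. set (N := (p - 2 * k)%nat) in *.
  assert (H1 := Nat.div_mod_eq N n). rewrite H, Nat.add_0_r in H1.
  rewrite H1 at 1. rewrite mult_INR. field. lra.
Qed.

(** * The limit as [lam] tends to [0] *)

Lemma is_lim_seq_sum (u : nat -> nat -> R) (v : nat -> R) n :
  (forall k, (k <= n)%nat -> is_lim_seq (fun i => u i k) (v k)) ->
  is_lim_seq (fun i => sum_f_R0 (u i) n) (sum_f_R0 v n).
Proof.
  induction n as [|n IH]; intros H; simpl; [apply H; lia|].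
  apply is_lim_seq_plus'; [apply IH; intros; apply H; lia|apply H; lia].
Qed.

Lemma is_lim_seq_poch (u : nat -> R) (l : R) k : is_lim_seq u l ->
  is_lim_seq (fun i => poch (u i) k) (poch l k).
Proof.
  intros Hu. induction k as [|k IH]; simpl; [apply is_lim_seq_const|].
  apply is_lim_seq_mult'; [easy|]. apply is_lim_seq_plus'; [easy|apply is_lim_seq_const].
Qed.

Lemma poch_1 k : poch 1 k = INR (fact k).
Proof.
  induction k as [|k IH]; [easy|].
  rewrite poch_S, IH, fact_simpl, mult_INR, S_INR. ring.
Qed.

(** These are the points at which [Lim] at [0] samples its argument, so limits along this sequence
    compute [geg_factor 0] directly. *)
Definition inv_S (i : nat) : R := / (INR i + 1).

Lemma inv_S_bounds i : 0 < inv_S i <= 1.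
Proof.
  assert (H := pos_INR i). unfold inv_S. split; [apply Rinv_0_lt_compat; lra|].
  rewrite <- Rinv_1. apply Rinv_le_contravar; lra.
Qed.

Lemma is_lim_seq_inv_S : is_lim_seq inv_S 0.
Proof.
  apply (is_lim_seq_inv _ p_infty); [|easy].
  apply is_lim_seq_ext with (fun k => INR (S k)); [intros; apply S_INR|].
  apply (is_lim_seq_incr_1 INR). apply is_lim_seq_INR.
Qed.

Lemma is_lim_seq_affine_inv_S a : is_lim_seq (fun i => a * inv_S i + 1) 1.
Proof.
  replace (Finite 1) with (Finite (a * 0 + 1)) by (f_equal; ring).
  apply is_lim_seq_plus'; [|apply is_lim_seq_const].
  apply is_lim_seq_mult'; [apply is_lim_seq_const|apply is_lim_seq_inv_S].
Qed.

(** The Pochhammer symbol of [lam] with [q + 1] factors is [lam] times that of [lam + 1] with [q]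
    factors, and the latter tends to [q!]. *)
Lemma is_lim_seq_bc_quotient q : is_lim_seq (fun i => bc (inv_S i) (S q) / inv_S i) (/ INR (S q)).
Proof.
  assert (Hf := INR_fact_lt_0 (S q)).
  apply is_lim_seq_ext with (fun i => poch (1 * inv_S i + 1) q / INR (fact (S q))).
  { intros i. assert (H := inv_S_bounds i). unfold bc.
    change (S q) with (1 + q)%nat at 2. rewrite poch_add. simpl (INR 1). simpl (poch _ 1).
    rewrite Rmult_1_l. field. lra. }
  replace (/ INR (S q)) with (poch 1 q / INR (fact (S q))).
  - apply is_lim_seq_div'; [|apply is_lim_seq_const|lra].
    apply is_lim_seq_poch, is_lim_seq_affine_inv_S.
  - rewrite poch_1, fact_simpl, mult_INR. assert (H := INR_fact_lt_0 q).
    assert (0 < INR (S q)) by (apply lt_0_INR; lia). field. lra.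
Qed.

(** Unlike [sum_f_R0] this sum can be empty, which matches the recursion of [hconv]. *)
Fixpoint sumn (f : nat -> R) (n : nat) : R :=
  match n with O => 0 | S n' => sumn f n' + f n' end.

Lemma sumn_sum_f_R0 f n : sumn f (S n) = sum_f_R0 f n.
Proof. induction n as [|n IH]; [simpl; ring|]. rewrite tech5, <- IH. easy. Qed.

(* To first order in [lam], [prod_k (1 - c_k r)^(-lam)] is [1 - lam sum_k ln (1 - c_k r)]. *)
Lemma is_lim_seq_hconv_quotient c n p :
  is_lim_seq (fun i => hconv (inv_S i) c n (S p) / inv_S i)
    (sumn (fun k => c k ^ S p / INR (S p)) n).
Proof.
  revert p. induction n as [|n IH]; intros p.
  - simpl. apply is_lim_seq_ext with (fun _ => 0); [intros; unfold Rdiv; ring|].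
    apply is_lim_seq_const.
  - set (L := sumn (fun k => c k ^ S p / INR (S p)) n).
    set (F := fun i k => hconv (inv_S i) c n k * (bc (inv_S i) (S p - k) * c n ^ (S p - k)) / inv_S i).
    apply is_lim_seq_ext with (fun i => F i 0%nat + sum_f_R0 (fun k => F i (S k)) p).
    { intros i. transitivity (sum_f_R0 (F i) (S p)).
      - now rewrite (decomp_sum (F i) (S p)) by lia.
      - simpl hconv. unfold PS_mult, Rdiv. rewrite (Rmult_comm (sum_f_R0 _ _)), <- sum_f_R0_scal.
        apply sum_eq. intros k _. unfold F, Rdiv. ring. }
    change (sumn (fun k => c k ^ S p / INR (S p)) (S n)) with (L + c n ^ S p / INR (S p)).
    rewrite Rplus_comm.
    apply is_lim_seq_plus'.
    + apply is_lim_seq_ext with (fun i => bc (inv_S i) (S p) / inv_S i * c n ^ S p).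
      { intros i. unfold F. rewrite hconv_0, Nat.sub_0_r. unfold Rdiv. ring. }
      unfold Rdiv. rewrite (Rmult_comm (c n ^ S p)).
      apply is_lim_seq_mult'; [apply is_lim_seq_bc_quotient|apply is_lim_seq_const].
    (* For [k < p] both factors are of order [lam], so their product divided by [lam] vanishes in
       the limit; at [k = p] the second factor is [1] and the induction hypothesis gives [L]. *)
    + replace L with (sum_f_R0 (fun k => if Nat.eqb k p then L else 0) p).
      * apply is_lim_seq_sum. intros k Hk. destruct (Nat.eqb_spec k p) as [->|Hkp].
        -- apply is_lim_seq_ext with (fun i => hconv (inv_S i) c n (S p) / inv_S i); [|apply IH].
           intros i. unfold F. rewrite Nat.sub_diag. unfold bc; simpl. unfold Rdiv. field.
           generalize (inv_S_bounds i). lra.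
        -- set (q := (p - k - 1)%nat).
           apply is_lim_seq_ext with (fun i => (hconv (inv_S i) c n (S k) / inv_S i) *
             (bc (inv_S i) (S q) / inv_S i) * c n ^ S q * inv_S i).
           { intros i. unfold F. replace (S p - S k)%nat with (S q) by (unfold q; lia).
             generalize (inv_S_bounds i). intros H. field. lra. }
           replace (Finite 0) with (Finite (sumn (fun j => c j ^ S k / INR (S k)) n * / INR (S q) *
             c n ^ S q * 0)) by (f_equal; ring).
           apply is_lim_seq_mult'; [|apply is_lim_seq_inv_S].
           apply is_lim_seq_mult'; [|apply is_lim_seq_const].
           apply is_lim_seq_mult'; [apply IH|apply is_lim_seq_bc_quotient].
      * destruct p as [|p]; [easy|]. rewrite tech5, Nat.eqb_refl, sum_f_R0_zero; [ring|].
        intros k Hk. destruct (Nat.eqb_spec k (S p)); [lia|easy].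
Qed.

(** As its parameters tend to [0] the Dirichlet law concentrates on the vertices of the simplex,
    each equally likely. For positive degree, numerator and denominator both vanish to first order
    in [lam], and one factor cancels. *)
Lemma is_lim_seq_dirichlet_moment c n p :
  is_lim_seq (fun i => dirichlet_moment (inv_S i) c (S n) p)
    (sum_f_R0 (fun k => c k ^ p) n / INR (S n)).
Proof.
  assert (Hn : 0 < INR (S n)) by (apply lt_0_INR; lia).
  destruct p as [|p].
  - apply is_lim_seq_ext with (fun _ => 1).
    + intros i. unfold dirichlet_moment. rewrite hconv_0. simpl. field.
    + replace (sum_f_R0 _ n / INR (S n)) with 1; [apply is_lim_seq_const|].
      simpl pow. rewrite sum_cte. field. lra.
  - assert (Hp : 0 < INR (S p)) by (apply lt_0_INR; lia).
    assert (Hf := INR_fact_lt_0 p).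
    apply is_lim_seq_ext with (fun i => INR (fact (S p)) *
      (hconv (inv_S i) c (S n) (S p) / inv_S i) / (INR (S n) * poch (INR (S n) * inv_S i + 1) p)).
    { intros i. assert (H := inv_S_bounds i). unfold dirichlet_moment.
      change (poch (INR (S n) * inv_S i) (S p)) with (poch (INR (S n) * inv_S i) (1 + p)).
      rewrite poch_add. replace (INR 1) with 1 by easy.
      replace (poch (INR (S n) * inv_S i) 1) with (INR (S n) * inv_S i) by (unfold poch; change (INR 0) with 0; ring).
      assert (0 < poch (INR (S n) * inv_S i + 1) p).
      { apply poch_pos. assert (0 < INR (S n) * inv_S i) by (apply Rmult_lt_0_compat; lra). lra. }
      field. lra. }
    replace (sum_f_R0 (fun k => c k ^ S p) n / INR (S n)) with
      (INR (fact (S p)) * sumn (fun k => c k ^ S p / INR (S p)) (S n) / (INR (S n) * poch 1 p)).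
    + apply is_lim_seq_div'.
      * apply is_lim_seq_mult'; [apply is_lim_seq_const|apply is_lim_seq_hconv_quotient].
      * apply is_lim_seq_mult'; [apply is_lim_seq_const|].
        apply is_lim_seq_poch, is_lim_seq_affine_inv_S.
      * rewrite poch_1. apply Rmult_integral_contrapositive_currified; lra.
    + rewrite sumn_sum_f_R0, poch_1, fact_simpl, mult_INR.
      rewrite (sum_eq _ (fun k => / INR (S p) * c k ^ S p)) by (intros; unfold Rdiv; ring).
      rewrite sum_f_R0_scal. field. lra.
Qed.

(** At degree [0] the quotient is [1 / lam] and diverges, so the recurrence for quotients has to
    start from degrees [1] and [2]. *)
Lemma Gegenbauer_quotient_2 lam x : lam <> 0 ->
  Gegenbauer lam 2 x / lam = 2 * x ^ 2 * (1 + lam) - 1.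
Proof.
  intros Hl. assert (H := Gegenbauer_rec lam x 0). simpl INR in H.
  replace (Gegenbauer lam 1 x) with (2 * lam * x) in H by easy.
  replace (Gegenbauer lam 0 x) with 1 in H by easy.
  apply Rmult_eq_reg_l with (2 * lam); [|lra].
  replace (2 * lam * (Gegenbauer lam 2 x / lam)) with ((1 + 1) * Gegenbauer lam 2 x) by (field; lra).
  rewrite H. ring.
Qed.

Lemma Gegenbauer_quotient_rec lam x j : lam <> 0 ->
  Gegenbauer lam (S (S (S j))) x / lam =
  (2 * x * (INR (S (S j)) + lam) * (Gegenbauer lam (S (S j)) x / lam)
  - (INR (S (S j)) + 2 * lam - 1) * (Gegenbauer lam (S j) x / lam)) / INR (S (S (S j))).
Proof.
  intros Hl. assert (H := Gegenbauer_rec lam x (S j)).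
  assert (0 < INR (S (S (S j)))) by (apply lt_0_INR; lia).
  apply Rmult_eq_reg_l with (INR (S (S (S j))) * lam); [|nra].
  replace (INR (S (S (S j))) * lam * (Gegenbauer lam (S (S (S j))) x / lam))
    with (INR (S (S (S j))) * Gegenbauer lam (S (S (S j))) x) by (field; lra).
  rewrite H. field. lra.
Qed.

(** The bound is uniform in [lam], hence passes to the limit at [0]. *)
Lemma Gegenbauer_quotient_bound lam x j : 0 < lam <= 1 -> Rabs x <= 1 ->
  Rabs (Gegenbauer lam (S j) x / lam) <= 3 ^ S j.
Proof.
  intros Hl Hx.
  assert (Hx2 : 0 <= x ^ 2 <= 1).
  { rewrite <- pow2_abs. generalize (Rabs_pos x). simpl. nra. }
  cut (Rabs (Gegenbauer lam (S j) x / lam) <= 3 ^ S j /\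
       Rabs (Gegenbauer lam (S (S j)) x / lam) <= 3 ^ S (S j)); [easy|].
  induction j as [|j [IH0 IH1]].
  - split.
    + replace (Gegenbauer lam 1 x / lam) with (2 * x)
        by (unfold Gegenbauer; simpl; field; lra).
      rewrite Rabs_mult, (Rabs_pos_eq 2); simpl; lra.
    + rewrite Gegenbauer_quotient_2 by lra. apply Rabs_le. simpl pow in *. nra.
  - split; [easy|]. rewrite Gegenbauer_quotient_rec by lra.
    set (E1 := Gegenbauer lam (S j) x / lam) in *. set (E2 := Gegenbauer lam (S (S j)) x / lam) in *.
    rewrite (S_INR (S (S j))). set (y := INR (S (S j))).
    assert (Hy : 2 <= y) by (unfold y; rewrite !S_INR; generalize (pos_INR j); lra).
    unfold Rdiv. rewrite Rabs_mult, (Rabs_pos_eq (/ (y + 1))) by (left; apply Rinv_0_lt_compat; lra).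
    apply Rmult_le_reg_r with (y + 1); [lra|]. rewrite Rmult_assoc, Rinv_l, Rmult_1_r by lra.
    apply Rle_trans with (2 * 1 * (y + 1) * 3 ^ S (S j) + (y + 1) * 3 ^ S j).
    + unfold Rminus at 1. eapply Rle_trans; [apply Rabs_triang|]. rewrite Rabs_Ropp, !Rabs_mult.
      rewrite (Rabs_pos_eq 2), (Rabs_pos_eq (y + lam)), (Rabs_pos_eq (y + 2 * lam - 1)) by lra.
      apply Rplus_le_compat.
      * apply Rmult_le_compat; [|apply Rabs_pos| |easy].
        { apply Rmult_le_pos; [|lra]. apply Rmult_le_pos; [lra|apply Rabs_pos]. }
        apply Rmult_le_compat; [|lra| |lra].
        { apply Rmult_le_pos; [lra|apply Rabs_pos]. }
        apply Rmult_le_compat_l; lra.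
      * apply Rmult_le_compat; [lra|apply Rabs_pos|lra|easy].
    + change (3 ^ S (S (S j))) with (3 * (3 * 3 ^ S j)). change (3 ^ S (S j)) with (3 * 3 ^ S j).
      assert (0 < 3 ^ S j) by (apply pow_lt; lra). nra.
Qed.

Lemma Gegenbauer_quotient_lim x j :
  exists G : R, is_lim_seq (fun i => Gegenbauer (inv_S i) (S j) x / inv_S i) G.
Proof.
  cut ((exists G : R, is_lim_seq (fun i => Gegenbauer (inv_S i) (S j) x / inv_S i) G) /\
       (exists G : R, is_lim_seq (fun i => Gegenbauer (inv_S i) (S (S j)) x / inv_S i) G)); [easy|].
  assert (Hne : forall i, inv_S i <> 0) by (intros i; generalize (inv_S_bounds i); lra).
  induction j as [|j [[G0 IH0] [G1 IH1]]].
  - split.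
    + exists (2 * x). apply is_lim_seq_ext with (fun _ => 2 * x); [|apply is_lim_seq_const].
      intros i. unfold Gegenbauer; simpl. field. apply Hne.
    + exists (2 * x ^ 2 * (1 + 0) - 1).
      apply is_lim_seq_ext with (fun i => 2 * x ^ 2 * (1 + inv_S i) - 1).
      { intros i. now rewrite Gegenbauer_quotient_2. }
      apply is_lim_seq_minus'; [|apply is_lim_seq_const].
      apply is_lim_seq_mult'; [apply is_lim_seq_const|].
      apply is_lim_seq_plus'; [apply is_lim_seq_const|apply is_lim_seq_inv_S].
  - split; [now exists G1|].
    exists ((2 * x * (INR (S (S j)) + 0) * G1 - (INR (S (S j)) + 2 * 0 - 1) * G0) / INR (S (S (S j)))).
    eapply is_lim_seq_ext; [intros i; symmetry; now apply Gegenbauer_quotient_rec|].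
    apply is_lim_seq_div'; [|apply is_lim_seq_const|apply not_0_INR; lia].
    apply is_lim_seq_minus'; (apply is_lim_seq_mult'; [|easy]).
    + apply is_lim_seq_mult'; [apply is_lim_seq_const|].
      apply is_lim_seq_plus'; [apply is_lim_seq_const|apply is_lim_seq_inv_S].
    + apply is_lim_seq_minus'; [|apply is_lim_seq_const].
      apply is_lim_seq_plus'; [apply is_lim_seq_const|].
      apply is_lim_seq_mult'; [apply is_lim_seq_const|apply is_lim_seq_inv_S].
Qed.

(** [real] and [Lim] are total, so the value means something only once the limit is known to exist
    and be finite. The base is [6 = 2 * 3]: the factor [j] is at most [2^j], the quotient at most
    [3^j]. *)
Lemma geg_factor_zero xi j : Rabs xi <= 1 ->
  is_lim_seq (fun i => (inv_S i + INR j) / inv_S i * Gegenbauer (inv_S i) j xi) (geg_factor 0 j xi)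
  /\ Rabs (geg_factor 0 j xi) <= 6 ^ j.
Proof.
  intros Hxi.
  assert (Hpos := inv_S_bounds).
  assert (H : exists G : R, is_lim_seq
    (fun i => (inv_S i + INR j) / inv_S i * Gegenbauer (inv_S i) j xi) G /\ Rabs G <= 6 ^ j).
  { destruct j as [|j].
    - exists 1. rewrite Rabs_R1. split; [|simpl; lra].
      apply is_lim_seq_ext with (fun _ => 1); [|apply is_lim_seq_const].
      intros i. specialize (Hpos i). unfold Gegenbauer; simpl. field. lra.
    - destruct (Gegenbauer_quotient_lim xi j) as [G HG].
      exists ((0 + INR (S j)) * G). split.
      + apply is_lim_seq_ext with (fun i => (inv_S i + INR (S j)) * (Gegenbauer (inv_S i) (S j) xi / inv_S i)).
        { intros i. specialize (Hpos i). field. lra. }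
        apply is_lim_seq_mult'; [|easy].
        apply is_lim_seq_plus'; [apply is_lim_seq_inv_S|apply is_lim_seq_const].
      + rewrite Rplus_0_l, Rabs_mult, Rabs_pos_eq by apply pos_INR.
        replace (6 ^ S j) with (2 ^ S j * 3 ^ S j) by (rewrite <- Rpow_mult_distr; f_equal; ring).
        apply Rmult_le_compat; [apply pos_INR|apply Rabs_pos| |].
        * apply Rle_trans with (INR (S (S j))); [apply le_INR; lia|apply INR_S_le_pow2].
        * change (Rbar_le (Rabs G) (3 ^ S j)).
          apply is_lim_seq_le with (fun i => Rabs (Gegenbauer (inv_S i) (S j) xi / inv_S i)) (fun _ => 3 ^ S j).
          -- intros i. now apply Gegenbauer_quotient_bound.
          -- now apply (is_lim_seq_abs _ G).
          -- apply is_lim_seq_const. }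
  destruct H as (G & HG & HGb).
  replace (geg_factor 0 j xi) with G; [now split|].
  unfold geg_factor. destruct (Req_EM_T 0 0) as [_|H]; [|easy].
  unfold Lim. rewrite (is_lim_seq_unique _ G); [easy|].
  apply is_lim_seq_ext with (2 := HG). intros i. unfold Rbar_loc_seq, inv_S.
  now rewrite Rplus_0_l.
Qed.

Lemma kernel_coefficient_identity_zero n th p :
  2 ^ p * (sum_f_R0 (fun k => cos (root_angle (S n) th k) ^ p) n / INR (S n)) / INR (fact p) =
  sum_f_R0 (fun k => gap (S n) (fun j => geg_factor 0 j (cos th)) (p - 2 * k) /
     (INR (fact k) * poch (INR (S n) * 0 + 1) (p - k))) (p / 2).
Proof.
  apply Rbar_finite_eq.
  set (u := fun i => 2 ^ p * dirichlet_moment (inv_S i) (fun k => cos (root_angle (S n) th k)) (S n) p /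
    INR (fact p)).
  transitivity (Lim_seq u).
  - symmetry. apply is_lim_seq_unique. unfold u.
    apply is_lim_seq_div'; [|apply is_lim_seq_const|apply INR_fact_neq_0].
    apply is_lim_seq_mult'; [apply is_lim_seq_const|].
    apply (is_lim_seq_dirichlet_moment (fun k => cos (root_angle (S n) th k))).
  - apply is_lim_seq_unique. unfold u.
    eapply is_lim_seq_ext.
    { intros i. symmetry. apply kernel_coefficient_identity; [|lia].
      apply (proj1 (inv_S_bounds i)). }
    apply is_lim_seq_sum. intros k Hk.
    apply is_lim_seq_div'.
    + unfold gap. destruct (Nat.eqb _ 0); [|apply is_lim_seq_const].
      apply geg_factor_zero. apply Rabs_le, COS_bound.
    + apply is_lim_seq_mult'; [apply is_lim_seq_const|].
      apply is_lim_seq_poch. rewrite Rmult_0_r, Rplus_0_l. apply is_lim_seq_affine_inv_S.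
    + apply Rmult_integral_contrapositive_currified; [apply INR_fact_neq_0|].
      assert (0 < poch (INR (S n) * 0 + 1) (p - k)) by (apply poch_pos; lra). lra.
Qed.

Lemma geg_factor_bound lam xi : 0 <= lam -> Rabs xi <= 1 ->
  exists A K, 0 <= A /\ 1 <= K /\ forall j, Rabs (geg_factor lam j xi) <= A * K ^ j.
Proof.
  intros Hl Hxi. destruct (Req_EM_T lam 0) as [->|H0].
  - exists 1, 6. split; [lra|]. split; [lra|]. intros j. rewrite Rmult_1_l.
    now apply geg_factor_zero.
  - assert (Hlp : 0 < lam) by lra.
    exists (1 + / lam), (2 * (3 + 2 * lam)).
    assert (Hi : 0 < / lam) by (now apply Rinv_0_lt_compat).
    split; [lra|]. split; [lra|]. intros j. unfold geg_factor.
    destruct (Req_EM_T lam 0) as [H|_]; [easy|].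
    rewrite Rabs_mult, Rpow_mult_distr, <- Rmult_assoc.
    apply Rmult_le_compat; [apply Rabs_pos|apply Rabs_pos| |now apply Gegenbauer_bound].
    assert (Hj := pos_INR j).
    rewrite Rabs_pos_eq by (apply Rmult_le_pos; lra).
    apply Rle_trans with ((1 + / lam) * INR (S j)).
    + rewrite S_INR. replace ((lam + INR j) / lam) with (1 + INR j * / lam) by (field; lra). nra.
    + apply Rmult_le_compat_l; [lra|apply INR_S_le_pow2].
Qed.

(** * Bessel series and the kernel *)

Lemma fact_le_poch nu k : 0 <= nu -> INR (fact k) <= poch (nu + 1) k.
Proof.
  intros Hnu. rewrite <- poch_1. induction k as [|k IH]; [simpl; lra|]. rewrite !poch_S.
  assert (0 < poch 1 k) by (apply poch_pos; lra). assert (Hk := pos_INR k).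
  apply Rmult_le_compat; lra.
Qed.

(** Up to sign, the [k]-th term of [Gamma (nu + 1) y^(- nu) J_(N + nu) (2 y)]. *)
Definition bessel_term (nu y : R) (N k : nat) : R :=
  y ^ (N + 2 * k) / (INR (fact k) * poch (nu + 1) (N + k)).

(** The Pochhammer symbol is at least [(N + k)!], hence at least [N!]. This separates [N] from [k],
    and the factor [1 / N!] outweighs the geometric growth of the Gegenbauer factors in the double
    series. *)
Lemma bessel_term_bound nu y N k : 0 <= nu -> 0 < y ->
  0 < bessel_term nu y N k <= y ^ N / INR (fact N) * ((y ^ 2) ^ k / INR (fact k)).
Proof.
  intros Hnu Hy. unfold bessel_term.
  assert (H1 := INR_fact_lt_0 k). assert (H2 := INR_fact_lt_0 N).
  assert (H3 : INR (fact N) <= poch (nu + 1) (N + k)).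
  { apply Rle_trans with (INR (fact (N + k))); [|now apply fact_le_poch].
    apply le_INR, fact_le. lia. }
  assert (H4 : 0 < y ^ (N + 2 * k)) by (now apply pow_lt).
  split.
  - apply Rdiv_lt_0_compat; [easy|]. apply Rmult_lt_0_compat; lra.
  - replace (y ^ N / INR (fact N) * ((y ^ 2) ^ k / INR (fact k))) with
      (y ^ (N + 2 * k) / (INR (fact k) * INR (fact N))).
    + apply Rmult_le_compat_l; [lra|]. apply Rinv_le_contravar; [now apply Rmult_lt_0_compat|].
      apply Rmult_le_compat_l; lra.
    + rewrite pow_add, pow_mult. field. lra.
Qed.

Lemma ex_series_bessel_term nu y N : 0 <= nu -> 0 < y -> ex_series (bessel_term nu y N).
Proof.
  intros Hnu Hy.
  apply (ex_series_le_R _ (fun k => y ^ N / INR (fact N) * ((y ^ 2) ^ k / INR (fact k)))).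
  - intros k. assert (H := bessel_term_bound nu y N k Hnu Hy). rewrite Rabs_pos_eq; lra.
  - eexists. apply is_series_scal_R, is_series_exp.
Qed.

Lemma Series_bessel_term_bound nu y N : 0 <= nu -> 0 < y ->
  0 <= Series (bessel_term nu y N) <= exp (y ^ 2) * (y ^ N / INR (fact N)).
Proof.
  intros Hnu Hy. assert (Hb := fun k => bessel_term_bound nu y N k Hnu Hy).
  assert (Hs := is_series_scal_R (y ^ N / INR (fact N)) _ _ (is_series_exp (y ^ 2))).
  split.
  - rewrite <- (is_series_unique _ _ is_series_zero). apply Series_le; [|now apply ex_series_bessel_term].
    intros k. specialize (Hb k). lra.
  - rewrite Rmult_comm, <- (is_series_unique _ _ Hs). apply Series_le; [|eexists; exact Hs].
    intros k. specialize (Hb k). lra.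
Qed.

Definition bessel_alt (nu y : R) (N : nat) : R :=
  Series (fun k => (-1) ^ k * bessel_term nu y N k).

Lemma Rabs_alternating k t : Rabs ((-1) ^ k * t) = Rabs t.
Proof. rewrite Rabs_mult, pow_1_abs. ring. Qed.

Lemma is_series_bessel_alt nu y N : 0 <= nu -> 0 < y ->
  is_series (fun k => (-1) ^ k * bessel_term nu y N k) (bessel_alt nu y N).
Proof.
  intros Hnu Hy. apply Series_correct.
  apply (ex_series_le_R _ (bessel_term nu y N)); [|now apply ex_series_bessel_term].
  intros k. rewrite Rabs_alternating. right. apply Rabs_pos_eq.
  left. now apply (bessel_term_bound nu y N k).
Qed.

(** [ph] stands for the real or the imaginary part of [i^N]; its second hypothesis lets it absorb
    the alternating sign of the Bessel series, so that every term of total degree [p] carries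
    [ph p]. Keeping [g] and [M] abstract treats [lam = 0] and [lam > 0] at once. *)
Lemma is_series_kernel (ph g M : nat -> R) n nu w A K :
  (0 < n)%nat -> 0 <= nu -> 0 < w ->
  (forall N, Rabs (ph N) <= 1) -> (forall N k, ph (N + 2 * k)%nat = (-1) ^ k * ph N) ->
  0 <= A -> 1 <= K -> (forall j, Rabs (g j) <= A * K ^ j) ->
  (forall p, 2 ^ p * M p / INR (fact p) =
     sum_f_R0 (fun k => gap n g (p - 2 * k) / (INR (fact k) * poch (nu + 1) (p - k))) (p / 2)) ->
  is_series (fun j => ph (n * j)%nat * (g j * bessel_alt nu (w / 2) (n * j)))
    (Series (fun p => w ^ p / INR (fact p) * ph p * M p)).
Proof.
  intros Hn Hnu Hw Hph1 Hph HA HK Hg HM. set (y := w / 2).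
  assert (Hy : 0 < y) by (unfold y; lra).
  set (a := fun N k => ph N * gap n g N * ((-1) ^ k * bessel_term nu y N k)).
  set (S := fun N => ph N * gap n g N * bessel_alt nu y N).
  set (Ba := fun N => Rabs (ph N * gap n g N) * Series (bessel_term nu y N)).
  assert (Ha : forall N, is_series (a N) (S N)).
  { intros N. apply is_series_scal_R. now apply is_series_bessel_alt. }
  assert (HBa : forall N, is_series (fun k => Rabs (a N k)) (Ba N)).
  { intros N. apply is_series_ext_R with (fun k => Rabs (ph N * gap n g N) * bessel_term nu y N k).
    - intros k. unfold a. rewrite (Rabs_mult (ph N * gap n g N)), Rabs_alternating. f_equal. symmetry.
      apply Rabs_pos_eq. left. now apply (bessel_term_bound nu y N k).
    - apply is_series_scal_R, Series_correct. now apply ex_series_bessel_term. }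
  assert (HBa_le : forall N, 0 <= Ba N <= A * exp (y ^ 2) * ((K * y) ^ N / INR (fact N))).
  { intros N. assert (Hb := Series_bessel_term_bound nu y N Hnu Hy). unfold Ba.
    split; [apply Rmult_le_pos; [apply Rabs_pos|lra]|].
    rewrite Rpow_mult_distr.
    replace (A * exp (y ^ 2) * (K ^ N * y ^ N / INR (fact N))) with
      ((A * K ^ N) * (exp (y ^ 2) * (y ^ N / INR (fact N)))) by (unfold Rdiv; ring).
    apply Rmult_le_compat; [apply Rabs_pos|lra| |lra].
    rewrite Rabs_mult, <- (Rmult_1_l (A * K ^ N)).
    apply Rmult_le_compat; [apply Rabs_pos|apply Rabs_pos|apply Hph1|].
    assert (0 <= A * K ^ N) by (apply Rmult_le_pos; [easy|apply pow_le; lra]).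
    unfold gap. destruct (Nat.eqb _ 0); [|now rewrite Rabs_R0].
    eapply Rle_trans; [apply Hg|]. apply Rmult_le_compat_l; [easy|].
    apply Rle_pow; [easy|]. now apply Nat.Div0.div_le_upper_bound; nia. }
  assert (HexB : ex_series Ba).
  { apply (ex_series_le_R _ (fun N => A * exp (y ^ 2) * ((K * y) ^ N / INR (fact N)))).
    - intros N. specialize (HBa_le N). rewrite Rabs_pos_eq; lra.
    - eexists. apply is_series_scal_R, is_series_exp. }
  assert (HexS : ex_series S).
  { apply (ex_series_le_R _ Ba); [|easy]. intros N.
    rewrite <- (is_series_unique _ _ (Ha N)), <- (is_series_unique _ _ (HBa N)).
    apply Series_Rabs. eexists; apply HBa. }
  destruct HexS as [l Hl].
  assert (Hdiag := is_series_diagonals a S Ba l Ha HBa HexB Hl).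
  assert (HF : is_series (fun j => ph (n * j)%nat * (g j * bessel_alt nu y (n * j))) l).
  { apply is_series_ungap with n; [easy|]. apply is_series_ext_R with (2 := Hl).
    intros N. unfold S, gap. destruct (Nat.eqb_spec (N mod n) 0) as [H|H]; [|ring].
    replace (n * (N / n))%nat with N; [ring|]. assert (H1 := Nat.div_mod_eq N n). lia. }
  rewrite (is_series_unique _ l); [exact HF|].
  apply is_series_ext_R with (2 := Hdiag). intros p.
  replace (w ^ p / INR (fact p) * ph p * M p) with
    (ph p * y ^ p * (2 ^ p * M p / INR (fact p))).
  - rewrite HM, <- sum_f_R0_scal. apply sum_eq. intros k Hk.
    assert (Hkp : (2 * k <= p)%nat) by (assert (H1 := Nat.div_mod_eq p 2); lia).
    unfold a, bessel_term. replace (p - 2 * k + 2 * k)%nat with p by lia.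
    replace (p - 2 * k + k)%nat with (p - k)%nat by lia.
    replace (ph p) with ((-1) ^ k * ph (p - 2 * k)%nat) by (rewrite <- Hph; f_equal; lia).
    unfold Rdiv. ring.
  - replace (w ^ p) with (2 ^ p * y ^ p).
    + unfold Rdiv. ring.
    + rewrite <- Rpow_mult_distr. f_equal. unfold y. field.
Qed.

Lemma Gamma_poch nu k : 0 <= nu -> Gamma (INR k + nu + 1) = Gamma (nu + 1) * poch (nu + 1) k.
Proof.
  intros Hnu. induction k as [|k IH].
  - simpl. rewrite Rplus_0_l. ring.
  - assert (Hk := pos_INR k). rewrite S_INR, poch_S.
    replace (INR k + 1 + nu + 1) with ((INR k + nu + 1) + 1) by ring.
    rewrite Gamma_succ, IH by lra. ring.
Qed.

Lemma BesselJ_bessel_alt nu N w : 0 <= nu -> 0 < w ->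
  Gamma (nu + 1) * BesselJ (INR N + nu) w = Rpower (w / 2) nu * bessel_alt nu (w / 2) N.
Proof.
  intros Hnu Hw. unfold BesselJ, bessel_alt. rewrite <- !Series_scal_l.
  apply Series_ext. intros k.
  destruct (Gamma_spec (nu + 1)) as [HG _]; [lra|].
  replace (INR k + (INR N + nu) + 1) with (INR (N + k) + nu + 1) by (rewrite plus_INR; ring).
  rewrite Gamma_poch by easy.
  replace (2 * INR k + (INR N + nu)) with (INR (N + 2 * k) + nu)
    by (rewrite plus_INR, mult_INR; simpl (INR 2); ring).
  rewrite Rpower_plus, Rpower_pow by lra. unfold bessel_term.
  assert (H1 := INR_fact_lt_0 k).
  assert (H2 : 0 < poch (nu + 1) (N + k)) by (apply poch_pos; lra).
  field. lra.
Qed.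

(** The three powers cancel: they are the [nu]-th powers of [2 / n], of [z^(- 1 / n)] and of
    [w / 2 = n z^(1 / n) / 2], whose product is [1]. The Gamma prefactor is absorbed by
    [bessel_alt]. *)
Lemma kernel_coef_eq n m x y j : (0 < n)%nat -> (2 <= m)%nat ->
  0 < normm m x * normm m y ->
  let lam := (INR m - 2) / 2 in
  let z := normm m x * normm m y in
  kernel_coef (2 / INR n) m x y j =
  geg_factor lam j (dotm m x y / z) *
  bessel_alt (INR n * lam) (INR n * Rpower z (/ INR n) / 2) (n * j).
Proof.
  intros Hn Hm Hz lam z. unfold kernel_coef. fold z in Hz |- *. fold lam.
  assert (Hn0 : 0 < INR n) by (apply lt_0_INR; lia).
  assert (Hl : 0 <= lam).
  { assert (H2 : INR 2 <= INR m) by (apply le_INR; lia). simpl (INR 2) in H2. unfold lam. lra. }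
  set (nu := INR n * lam).
  assert (Hnu : 0 <= nu) by (apply Rmult_le_pos; lra).
  replace (2 * lam / (2 / INR n)) with nu by (unfold nu; field; lra).
  replace ((2 * lam + 2 / INR n) / (2 / INR n)) with (nu + 1) by (unfold nu; field; lra).
  replace (2 * (INR j + lam) / (2 / INR n)) with (INR (n * j) + nu)
    by (rewrite mult_INR; unfold nu; field; lra).
  replace (2 / INR n / 2) with (/ INR n) by (field; lra).
  replace (2 / (2 / INR n)) with (INR n) by (field; lra).
  set (w := INR n * Rpower z (/ INR n)).
  assert (Hw : 0 < w) by (apply Rmult_lt_0_compat; [easy|apply exp_pos]).
  assert (HP : Rpower (2 / INR n) nu * Rpower z (- lam) * Rpower (w / 2) nu = 1).
  { replace (Rpower z (- lam)) with (Rpower (Rpower z (- / INR n)) nu).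
    - assert (H1 : 0 < 2 / INR n) by (apply Rdiv_lt_0_compat; lra).
      assert (H2 : 0 < Rpower z (- / INR n)) by apply exp_pos.
      assert (H3 : 0 < 2 / INR n * Rpower z (- / INR n)) by (now apply Rmult_lt_0_compat).
      rewrite !Rpower_mult_distr by lra.
      replace (2 / INR n * Rpower z (- / INR n) * (w / 2)) with 1.
      + unfold Rpower. now rewrite ln_1, Rmult_0_r, exp_0.
      + unfold w. rewrite Rpower_Ropp. assert (0 < Rpower z (/ INR n)) by apply exp_pos.
        field. lra.
    - rewrite Rpower_mult. f_equal. unfold nu. field. lra. }
  assert (HB := BesselJ_bessel_alt nu (n * j) w Hnu Hw).
  set (B := BesselJ _ _) in *. set (G := geg_factor _ _ _).
  replace (Rpower (2 / INR n) nu * Gamma (nu + 1) * G * Rpower z (- lam) * B) with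
    (Rpower (2 / INR n) nu * G * Rpower z (- lam) * (Gamma (nu + 1) * B)) by ring.
  rewrite HB.
  replace (Rpower (2 / INR n) nu * G * Rpower z (- lam) * (Rpower (w / 2) nu * bessel_alt nu (w / 2) (n * j)))
    with ((Rpower (2 / INR n) nu * Rpower z (- lam) * Rpower (w / 2) nu) *
      (G * bessel_alt nu (w / 2) (n * j))) by ring.
  rewrite HP. ring.
Qed.

(** * The angle between two vectors, and the conclusion *)

Lemma dotm_self_pos m x : nonzero_vec m x -> 0 < dotm m x x.
Proof.
  intros (i & Hi & Hx). destruct m as [|m]; [lia|]. simpl.
  apply Rlt_le_trans with (x i * x i); [nra|].
  assert (Hsq : forall k, 0 <= x k * x k) by (intros; nra).
  assert (Him : (i <= m)%nat) by lia. clear Hi. induction Him as [|m Him IH].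
  - destruct i as [|i]; [simpl; lra|]. rewrite tech5.
    assert (0 <= sum_f_R0 (fun k => x k * x k) i) by (now apply cond_pos_sum). lra.
  - rewrite tech5. specialize (Hsq (S m)). lra.
Qed.

(** The vector [A y - D x] has squared norm [A (A B - D^2)]. *)
Lemma dotm_cauchy_schwarz m x y : 0 < dotm m x x ->
  dotm m x y * dotm m x y <= dotm m x x * dotm m y y.
Proof.
  destruct m as [|m]; simpl; [lra|]. intros HA.
  set (A := sum_f_R0 (fun i => x i * x i) m) in *.
  set (B := sum_f_R0 (fun i => y i * y i) m).
  set (D := sum_f_R0 (fun i => x i * y i) m).
  assert (H : sum_f_R0 (fun i => (A * y i - D * x i) * (A * y i - D * x i)) m = A * (A * B - D * D)).
  { rewrite (sum_eq _ (fun i => A * A * (y i * y i) + (- 2 * A * D * (x i * y i) + D * D * (x i * x i))))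
      by (intros; ring).
    rewrite !plus_sum, !sum_f_R0_scal. fold A B D. ring. }
  assert (H0 : 0 <= A * (A * B - D * D)).
  { rewrite <- H. apply cond_pos_sum. intros; apply Rle_0_sqr. }
  apply Rnot_lt_le. intros Hlt. nra.
Qed.

Lemma normm_mult_pos m x y : nonzero_vec m x -> nonzero_vec m y -> 0 < normm m x * normm m y.
Proof. intros Hx Hy. apply Rmult_lt_0_compat; apply sqrt_lt_R0; now apply dotm_self_pos. Qed.

Lemma cosine_bound m x y : nonzero_vec m x -> nonzero_vec m y ->
  -1 <= dotm m x y / (normm m x * normm m y) <= 1.
Proof.
  intros Hx Hy. assert (Hz := normm_mult_pos m x y Hx Hy).
  assert (HA := dotm_self_pos m x Hx). assert (HB := dotm_self_pos m y Hy).
  assert (HC := dotm_cauchy_schwarz m x y HA).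
  set (z := normm m x * normm m y) in *.
  assert (Hzz : z * z = dotm m x x * dotm m y y).
  { unfold z, normm. rewrite <- (sqrt_sqrt (dotm m x x)) at 3 by lra.
    rewrite <- (sqrt_sqrt (dotm m y y)) at 3 by lra. ring. }
  rewrite <- Hzz in HC.
  assert (- z <= dotm m x y <= z) by (split; nra).
  split; apply Rmult_le_reg_r with z; try easy; unfold Rdiv; rewrite Rmult_assoc, Rinv_l; lra.
Qed.

Theorem theorem12 (n m : nat) (x y : nat -> R) :
  (0 < n)%nat -> (2 <= m)%nat ->
  nonzero_vec m x -> nonzero_vec m y ->
  Cmod (Kernel (2 / INR n) m x y) <= 1.
Proof.
  intros Hn Hm Hx Hy.
  assert (Hn0 : 0 < INR n) by (apply lt_0_INR; lia).
  set (lam := (INR m - 2) / 2). set (z := normm m x * normm m y).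
  assert (Hz : 0 < z) by (now apply normm_mult_pos).
  assert (Hxi := cosine_bound m x y Hx Hy). fold z in Hxi.
  set (th := acos (dotm m x y / z)).
  assert (Hth : dotm m x y / z = cos th) by (symmetry; now apply cos_acos).
  set (w := INR n * Rpower z (/ INR n)).
  assert (Hw : 0 < w) by (apply Rmult_lt_0_compat; [easy|apply exp_pos]).
  assert (Hcoef : forall j, kernel_coef (2 / INR n) m x y j =
    geg_factor lam j (cos th) * bessel_alt (INR n * lam) (w / 2) (n * j)).
  { intros j. rewrite <- Hth. now apply kernel_coef_eq. }
  assert (Hl : 0 <= lam).
  { assert (H2 : INR 2 <= INR m) by (apply le_INR; lia). simpl (INR 2) in H2. unfold lam. lra. }
  assert (HM : exists M, positive_moments M /\
    forall p, 2 ^ p * M p / INR (fact p) =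
     sum_f_R0 (fun k => gap n (fun j => geg_factor lam j (cos th)) (p - 2 * k) /
       (INR (fact k) * poch (INR n * lam + 1) (p - k))) (p / 2)).
  (* [m = 2] is [lam = 0], where [geg_factor] is a limit and the law is uniform; otherwise
     [2 lam = m - 2] is a positive integer and the law is Dirichlet. *)
  { destruct n as [|n]; [lia|]. destruct (Nat.eq_dec m 2) as [Hm2|Hm2].
    - assert (Hl0 : lam = 0) by (unfold lam; rewrite Hm2; simpl; field). rewrite Hl0.
      exists (fun p => sum_f_R0 (fun k => cos (root_angle (S n) th k) ^ p) n / INR (S n)). split.
      + apply (positive_moments_average (fun k => cos (root_angle (S n) th k))).
        intros; apply COS_bound.
      + intros p. apply kernel_coefficient_identity_zero.
    - assert (Hd : lam = INR (m - 2) / 2).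
      { unfold lam. rewrite minus_INR by lia. simpl (INR 2). field. }
      assert (Hlp : 0 < lam) by (rewrite Hd; apply Rdiv_lt_0_compat; [apply lt_0_INR; lia|lra]).
      exists (dirichlet_moment lam (fun k => cos (root_angle (S n) th k)) (S n)). split.
      + rewrite Hd. apply positive_moments_dirichlet; [lia|]. intros; apply COS_bound.
      + intros p. rewrite kernel_coefficient_identity by (easy || lia).
        apply sum_eq. intros k _. f_equal. unfold gap, geg_factor.
        destruct (Req_EM_T lam 0) as [H|_]; [lra|easy]. }
  destruct HM as (M & HMpos & HMid).
  destruct (geg_factor_bound lam (cos th) Hl (Rabs_le _ _ (COS_bound th))) as (A & K & HA & HK & Hg).
  assert (Hnu : 0 <= INR n * lam) by (apply Rmult_le_pos; lra).
  assert (Harg : forall N k, INR (N + 2 * k) * (PI / 2) = INR k * PI + INR N * (PI / 2)).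
  { intros N k. rewrite plus_INR, mult_INR. simpl (INR 2). field. }
  assert (Hcos := is_series_kernel (fun N => cos (INR N * (PI / 2))) _ M n _ w A K Hn Hnu Hw
    (fun N => Rabs_le _ _ (COS_bound _))
    (fun N k => ltac:(cbv beta; rewrite Harg, cos_plus, cos_INR_PI, sin_INR_PI; ring))
    HA HK Hg HMid).
  assert (Hsin := is_series_kernel (fun N => sin (INR N * (PI / 2))) _ M n _ w A K Hn Hnu Hw
    (fun N => Rabs_le _ _ (SIN_bound _))
    (fun N k => ltac:(cbv beta; rewrite Harg, sin_plus, cos_INR_PI, sin_INR_PI; ring))
    HA HK Hg HMid).
  set (X := Series (fun p => w ^ p / INR (fact p) * cos (INR p * (PI / 2)) * M p)) in *.
  set (Y := Series (fun p => w ^ p / INR (fact p) * sin (INR p * (PI / 2)) * M p)) in *.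
  assert (Hang : forall j, PI * INR j / (2 / INR n) = INR (n * j) * (PI / 2)).
  { intros j. rewrite mult_INR. field. lra. }
  assert (HK' : Kernel (2 / INR n) m x y = (X, - Y)).
  { unfold Kernel. f_equal.
    - apply is_series_unique. apply is_series_ext_R with (2 := Hcos).
      intros j. now rewrite Hcoef, Hang.
    - rewrite <- (is_series_unique _ _ Hsin), <- Series_opp. apply Series_ext.
      intros j. rewrite Hcoef, Hang. ring. }
  assert (HXY : X ^ 2 + Y ^ 2 <= 1).
  { assert (HMb := fun p => positive_moments_bounded M p HMpos).
    apply (positive_moments_fourier_bound M w X Y HMpos); apply Series_correct.
    - apply (ex_series_moments M (fun p => cos (INR p * (PI / 2)))); [easy|].
      intros; apply Rabs_le, COS_bound.
    - apply (ex_series_moments M (fun p => sin (INR p * (PI / 2)))); [easy|].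
      intros; apply Rabs_le, SIN_bound. }
  rewrite HK'. unfold Cmod. simpl fst; simpl snd. rewrite <- sqrt_1. apply sqrt_le_1_alt.
  simpl in *. lra.
Qed.
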